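(* For $n\ge 0$ let $\mathcal{L}_n$ be the Linial arrangement in $\mathbb{R}^n$, consisting of the hyperplanes $x_i-x_j=1$ for $1\le i<j\le n$. Define formal power series $A_r(x)$, $r\ge 0$, by $$\frac{1+ye^{x(1+y)}}{1-y^2e^{x(1+y)}}=\sum_{r\ge 0}A_r(x)y^r.$$ Then $$\sum_{n\ge 0}\chi_{\mathcal{L}_n}(q)\frac{x^n}{n!}=\left(\lim_{r\to\infty}\frac{A_r(x)}{A_{r-1}(x)}\right)^q.$$ In particular, if $f_n$ is the number of alternating trees on $[n+1]$, then $$\sum_{n\ge 0}(-1)^nf_n\frac{x^n}{n!}=\lim_{r\to\infty}\frac{A_{r-1}(x)}{A_r(x)}.$$ The limits are in the sense of convergence of formal power series.
   Context: For a hyperplane arrangement $\mathcal{A}$ (finite set of affine hyperplanes) in $\mathbb{R}^n$, the intersection poset $L_{\mathcal{A}}$ is the set of non-empty intersections of subsets of $\mathcal{A}$ (including the empty intersection $\hat 0=\mathbb{R}^n$), ordered by reverse inclusion; $r(x)=n-\dim x$ for $x\in L_{\mathcal{A}}$. The characteristic polynomial is $\chi_{\mathcal{A}}(q)=\sum_{x\in L_{\mathcal{A}}}\mu(\hat 0,x)\,q^{n-r(x)}$, where $\mu$ is the Möbius function of $L_{\mathcal{A}}$ (so it is $1$ for $n=0$). An alternating tree on $[m]=\{1,\ldots,m\}$ is a tree with vertex set $[m]$ in which every vertex is either larger than all its neighbors or smaller than all its neighbors. For a formal power series $F$ in $x$ with constant term $1$, $F^q=\exp(q\log F)$, with $q$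 an indeterminate. Convergence: $\lim_{r\to\infty}F_r(x)=F(x)$ means that for every $b$ the coefficient of $x^b$ in $F_r(x)$ equals that in $F(x)$ for all sufficiently large $r$. *)

(* Defs.v *)
From HB Require Import structures.
From mathcomp Require Import all_boot all_order all_algebra.
From mathcomp Require Import finmap.
From mathcomp Require Import boolp classical_sets reals.

Set Implicit Arguments.
Unset Strict Implicit.
Unset Printing Implicit Defensive.

Import Order.TTheory GRing.Theory Num.Theory.

Local Open Scope ring_scope.

Record fps (R : Type) : Type := Fps { fps_coef :> nat -> R }.

HB.instance Definition _ (R : Type) := gen_eqMixin (fps R).
HB.instance Definition _ (R : Type) := gen_choiceMixin (fps R).

Lemma fpsP (R : Type) (f g : fps R) : (forall n, f n = g n) <-> f = g.
Proof.
split=> [|-> //]; case: f g => [f] [g] /= e.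
by congr Fps; apply/funext.
Qed.

Section FpsZmod.
Variable R : zmodType.

Definition fps_zero : fps R := Fps (fun=> 0).
Definition fps_opp (f : fps R) : fps R := Fps (fun n => - f n).
Definition fps_add (f g : fps R) : fps R := Fps (fun n => f n + g n).

Fact fps_addA : associative fps_add.
Proof. by move=> f g h; apply/fpsP => n; apply: addrA. Qed.
Fact fps_addC : commutative fps_add.
Proof. by move=> f g; apply/fpsP => n; apply: addrC. Qed.
Fact fps_add0 : left_id fps_zero fps_add.
Proof. by move=> f; apply/fpsP => n; apply: add0r. Qed.
Fact fps_addN : left_inverse fps_zero fps_opp fps_add.
Proof. by move=> f; apply/fpsP => n; apply: addNr. Qed.

HB.instance Definition _ :=
  GRing.isZmodule.Build (fps R) fps_addA fps_addC fps_add0 fps_addN.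

Lemma fps_coef0 n : (0 : fps R) n = 0. Proof. by []. Qed.
Lemma fps_coefN (f : fps R) n : (- f) n = - f n. Proof. by []. Qed.
Lemma fps_coefD (f g : fps R) n : (f + g) n = f n + g n. Proof. by []. Qed.
Lemma fps_coefB (f g : fps R) n : (f - g) n = f n - g n. Proof. by []. Qed.
Lemma fps_coef_sum (I : Type) (s : seq I) (P : pred I) (F : I -> fps R) n :
  (\sum_(i <- s | P i) F i) n = \sum_(i <- s | P i) F i n.
Proof. by elim/big_rec2: _ => // i _ y _ <-. Qed.

End FpsZmod.

Section FpsRing.
Variable R : comNzRingType.

Definition fpsC (c : R) : fps R := Fps (fun n => if n == 0%N then c else 0).
Definition fpsX : fps R := Fps (fun n => (n == 1%N)%:R).
Definition fps_mul (f g : fps R) : fps R :=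
  Fps (fun n => \sum_(i < n.+1) f i * g (n - i)%N).

Definition fps_trunc (N : nat) (f : fps R) : {poly R} := \poly_(i < N.+1) f i.

Lemma coef_fps_trunc N f i : (i <= N)%N -> (fps_trunc N f)`_i = f i.
Proof. by move=> le_iN; rewrite coef_poly ltnS le_iN. Qed.

Lemma fps_mul_trunc N f g n : (n <= N)%N ->
  fps_mul f g n = (fps_trunc N f * fps_trunc N g)`_n.
Proof.
move=> le_nN; rewrite coefM; apply: eq_bigr => i _.
have le_iN : (i <= N)%N by apply: leq_trans le_nN; rewrite -ltnS.
by rewrite !coef_fps_trunc // (leq_trans (leq_subr _ _)).
Qed.

Fact fps_mulC : commutative fps_mul.
Proof.
by move=> f g; apply/fpsP => n; rewrite !(fps_mul_trunc _ _ (leqnn n)) mulrC.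
Qed.

Fact fps_mulA : associative fps_mul.
Proof.
move=> f g h; apply/fpsP => n.
transitivity ((fps_trunc n f * (fps_trunc n g * fps_trunc n h))`_n).
  rewrite coefM; apply: eq_bigr => i _.
  by rewrite coef_fps_trunc -1?ltnS // (fps_mul_trunc _ _ (leq_subr i n)).
rewrite mulrA coefM; apply: eq_bigr => i _.
by rewrite coef_fps_trunc ?leq_subr // -fps_mul_trunc // -ltnS.
Qed.

Fact fps_mul1 : left_id (fpsC 1) fps_mul.
Proof.
move=> f; apply/fpsP => n; rewrite /= big_ord_recl /= mul1r subn0.
by rewrite big1 ?addr0 // => i _; rewrite mul0r.
Qed.

Fact fps_mulDl : left_distributive fps_mul (@fps_add R).
Proof.
move=> f g h; apply/fpsP => n; rewrite /= -big_split.
by apply: eq_bigr => i _; apply: mulrDl.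
Qed.

Fact fps_1neq0 : fpsC 1 != 0.
Proof. by apply/eqP => /fpsP/(_ 0%N)/eqP; rewrite /= oner_eq0. Qed.

HB.instance Definition _ := GRing.Zmodule_isComNzRing.Build (fps R)
  fps_mulA fps_mulC fps_mul1 fps_mulDl fps_1neq0.

Lemma fps_coefC c n : fpsC c n = if n == 0%N then c else 0.
Proof. by []. Qed.
Lemma fps_coef1 n : (1 : fps R) n = (n == 0%N)%:R.
Proof. by rewrite [LHS]/=; case: eqP. Qed.
Lemma fps_coefM (f g : fps R) n :
  (f * g) n = \sum_(i < n.+1) f i * g (n - i)%N.
Proof. by []. Qed.
Lemma fps_coef0M (f g : fps R) : (f * g) 0%N = f 0%N * g 0%N.
Proof. by rewrite fps_coefM big_ord1. Qed.
Lemma fps_coefCM c (f : fps R) n : (fpsC c * f) n = c * f n.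
Proof.
rewrite fps_coefM big_ord_recl /= subn0 big1 ?addr0 // => i _.
by rewrite mul0r.
Qed.

Lemma fps_coef_exp_small (u : fps R) k n :
  u 0%N = 0 -> (n < k)%N -> (u ^+ k) n = 0.
Proof.
move=> u0; elim: k n => // k IHk n lt_nk; rewrite exprS fps_coefM.
apply: big1 => -[[|i] /= lt_in] _; first by rewrite u0 mul0r.
by rewrite IHk ?mulr0 // ltn_subLR // addSn ltnS (leq_trans _ (leq_addl _ _)).
Qed.

End FpsRing.

Section FpsUnitRing.
Variable R : comUnitRingType.

Definition fps_unit : pred (fps R) := fun f => f 0%N \is a GRing.unit.

(* the geometric series f0^-1 * sum_k (1 - f0^-1 f)^k, with f0 = f 0 *)
Definition fps_inv (f : fps R) : fps R :=
  if fps_unit f then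
    fpsC (f 0%N)^-1 *
    Fps (fun n => (\sum_(k < n.+1) (1 - fpsC (f 0%N)^-1 * f) ^+ k) n)
  else f.

Fact fps_mulVf : {in fps_unit, left_inverse 1 fps_inv *%R}.
Proof.
move=> f uf; rewrite /fps_inv ifT //; set c := fpsC _; set u := 1 - c * f.
have u0 : u 0%N = 0.
  by rewrite /u fps_coefB fps_coefCM fps_coef1 mulVr ?subrr.
have cf : c * f = 1 - u by rewrite /u opprB addrC subrK.
rewrite mulrAC cf; apply/fpsP => n.
transitivity (((1 - u) * \sum_(k < n.+1) u ^+ k) n); last first.
  rewrite -[1 - u]opprB mulNr -subrX1 opprB fps_coefB.
  by rewrite (fps_coef_exp_small u0 (ltnSn n)) subr0.
rewrite !fps_coefM; apply: eq_bigr => i _; congr (_ * _).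
rewrite [LHS]/= !fps_coef_sum.
rewrite -(big_mkord xpredT (fun k => (u ^+ k) (n - i)%N)).
rewrite -(big_mkord xpredT (fun k => (u ^+ k) (n - i)%N)).
have le : ((n - i).+1 <= n.+1)%N by rewrite ltnS leq_subr.
rewrite [RHS](big_cat_nat (leq0n _) le) /= [X in _ = _ + X]big1_seq ?addr0 // => k.
by rewrite mem_index_iota => /andP[_ /andP[lt_k _]]; apply: fps_coef_exp_small.
Qed.

Fact fps_unitP : forall f g : fps R, g * f = 1 -> fps_unit f.
Proof.
move=> f g /fpsP/(_ 0%N); rewrite fps_coef0M fps_coef1 /= => gf1.
by apply/unitrPr; exists (g 0%N); rewrite mulrC.
Qed.

Fact fps_inv_out : {in [predC fps_unit], fps_inv =1 id}.
Proof. by move=> f nuf; rewrite /fps_inv ifN. Qed.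

HB.instance Definition _ := GRing.ComNzRing_hasMulInverse.Build (fps R)
  fps_mulVf fps_unitP fps_inv_out.

(* exp G is meaningful when G has zero constant term and R contains the
   rationals; then G ^+ k does not contribute to the coefficient of degree
   n < k.  The same remark applies to log F, for F of constant term 1. *)
Definition fps_exp (G : fps R) : fps R :=
  Fps (fun n => \sum_(k < n.+1) (G ^+ k) n / k`!%:R).

Definition fps_log (F : fps R) : fps R :=
  Fps (fun n => \sum_(1 <= k < n.+1) (-1) ^+ k.-1 * ((F - 1) ^+ k) n / k%:R).

Definition egf (a : nat -> R) : fps R := Fps (fun n => a n / n`!%:R).

End FpsUnitRing.

Arguments fpsX {R}.

Definition fps_map (R S : Type) (h : R -> S) (F : fps R) : fps S :=
  Fps (fun n => h (F n)).

(* F ^ q = exp (q log F), the indeterminate q being 'X : {poly rat} *)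
Definition fps_powq (F : fps rat) : fps {poly rat} :=
  fps_exp (fpsC 'X * fps_map polyC (fps_log F)).

Definition fps_lim (R : Type) (u : nat -> fps R) (F : fps R) : Prop :=
  forall b, exists N, forall r, (N <= r)%N -> u r b = F b.

Section Moebius.
Context {d : Order.disp_t} {T : finPOrderType d}.
Implicit Types x y : T.

(* The first argument is fuel; see moebius_xx, moebius_lt and moebius_out for
   the defining recursion. *)
Fixpoint moebius_rec (k : nat) (x y : T) : int :=
  if x == y then 1 else
  if k is k'.+1 then
    if (x < y)%O then - \sum_(z | (x <= z < y)%O) moebius_rec k' x z else 0
  else 0.

Definition moebius (x y : T) : int := moebius_rec #|T| x y.

Lemma moebius_rec_stable k l x y :
  (#|[pred z | (z < y)%O]| <= k)%N -> (#|[pred z | (z < y)%O]| <= l)%N ->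
  moebius_rec k x y = moebius_rec l x y.
Proof.
have card0 w : (#|[pred z | (z < w)%O]| <= 0)%N -> (x < w)%O = false.
  by rewrite leqn0 => /eqP/card0_eq/(_ x).
elim: k l y => [|k IHk] [|l] y //=.
- by move=> /card0-> _.
- by move=> _ /card0->.
move=> le_k le_l; case: eqP => // _; case: ifP => // _.
congr (- _); apply: eq_bigr => z /andP[_ lt_zy].
have lt_card : (#|[pred w | (w < z)%O]| < #|[pred w | (w < y)%O]|)%N.
  apply: proper_card; apply/properP; split.
    by apply/fintype.subsetP => w; rewrite !inE => /lt_trans; apply.
  by exists z; rewrite !inE ?ltxx.
by apply: IHk; rewrite -ltnS (leq_trans lt_card).
Qed.

Lemma moebius_xx x : moebius x x = 1.
Proof. by rewrite /moebius; case: #|T| => [|k] /=; rewrite eqxx. Qed.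

Lemma moebius_lt x y : (x < y)%O ->
  moebius x y = - \sum_(z | (x <= z < y)%O) moebius x z.
Proof.
move=> lt_xy; rewrite {1}/moebius.
rewrite (@moebius_rec_stable _ #|T|.+1) ?max_card ?(leqW (max_card _)) //=.
by rewrite lt_xy (lt_eqF lt_xy).
Qed.

Lemma moebius_out x y : ~~ (x <= y)%O -> moebius x y = 0.
Proof.
move=> nle; rewrite /moebius; have nxy : x != y.
  by apply: contraNneq nle => ->.
have nlt : (x < y)%O = false by apply: contraNF nle => /ltW.
by case: #|T| => [|k] /=; rewrite (negPf nxy) ?nlt.
Qed.

End Moebius.

Local Open Scope classical_set_scope.

Section Arrangement.
Variables (R : realType) (n : nat).
Implicit Types (X : set 'rV[R]_n) (U : {vspace 'rV[R]_n}).

Definition is_hyperplane X : Prop :=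
  exists a : 'rV[R]_n, exists b : R,
    a != 0 /\ X = [set v : 'rV[R]_n | \sum_i a 0 i * v 0 i = b].

Record arrangement : Type := Arrangement {
  planes :> {fset set 'rV[R]_n};
  planesP : forall X, X \in planes -> is_hyperplane X
}.

Definition is_direction X U : Prop :=
  exists p : 'rV[R]_n, X = [set p + u | u in [set u : 'rV[R]_n | u \in U]].

(* For a (nonempty) affine subspace X there is exactly one U such that
   is_direction X U. *)
Definition affine_dim X : nat := \dim (xget 0%VS [set U | is_direction X U]).

Variable A : arrangement.

Definition intersection (B : {fset set 'rV[R]_n}) : set 'rV[R]_n :=
  \bigcap_(H in [set` B]) H.

Definition flats : {fset set 'rV[R]_n} :=
  [fset X in [fset intersection B | B in fpowerset A]
    | `[< X !=set0 >]]%fset.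

Definition intersection_poset : Type := flats.
Local Notation L := intersection_poset.

HB.instance Definition _ := Finite.copy L flats.

Definition flat_le (x y : L) : bool := `[< fsval y `<=` fsval x >].

Fact flat_le_refl : reflexive flat_le.
Proof. by move=> x; apply/asboolP. Qed.
Fact flat_le_anti : antisymmetric flat_le.
Proof.
move=> x y /andP[/asboolP yx /asboolP xy].
by apply: val_inj; apply/seteqP.
Qed.
Fact flat_le_trans : transitive flat_le.
Proof.
move=> y x z /asboolP yx /asboolP zy; apply/asboolP.
exact: subset_trans zy yx.
Qed.

Fact flat_display : Order.disp_t. Proof. exact: Order.Disp tt tt. Qed.

HB.instance Definition _ := Order.Le_isPOrder.Build flat_display L
  flat_le_refl flat_le_anti flat_le_trans.

Fact setT_flat : [set: 'rV[R]_n] \in flats.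
Proof.
rewrite !inE /=; apply/andP; split; last by apply/asboolP; exists 0.
apply/imfsetP; exists fset0 => /=; first by rewrite fpowersetE fsub0set.
by apply/seteqP; split=> // v _ H.
Qed.

Definition flat0 : L := FSetSub setT_flat.

Definition flat_rank (x : L) : nat := (n - affine_dim (fsval x))%N.

Definition chi : {poly int} :=
  \sum_(x : L) moebius flat0 x *: 'X^(n - flat_rank x).

End Arrangement.

Section Linial.
Variables (R : realType) (n : nat).

Definition linial_planes : {fset set 'rV[R]_n} :=
  [fset [set v : 'rV[R]_n | v 0 ij.1 - v 0 ij.2 = 1]
    | ij in [pred ij : 'I_n * 'I_n | (ij.1 < ij.2)%N]]%fset.

Fact linial_planesP X : X \in linial_planes -> is_hyperplane X.
Proof.
move=> /imfsetP[[i j] /= lt_ij ->].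
have {}lt_ij : (i < j)%N := lt_ij.
have nij : (i == j) = false by apply/eqP => eij; rewrite eij ltnn in lt_ij.
exists (delta_mx 0 i - delta_mx 0 j), 1; split.
  apply/eqP => /matrixP/(_ 0 i); rewrite !mxE !eqxx nij /= subr0.
  by move/eqP; rewrite oner_eq0.
apply/seteqP; split=> v /=;
  rewrite (bigD1 i) // (bigD1 j) 1?eq_sym ?nij //= !mxE !eqxx nij;
  rewrite [j == i]eq_sym nij /= subr0 sub0r mul1r mulN1r big1 ?addr0 //;
  by move=> k /andP[/negPf ki /negPf kj]; rewrite !mxE ki kj andbF subrr mul0r.
Qed.

Definition linial : arrangement R n := Arrangement linial_planesP.

End Linial.

Local Close Scope classical_set_scope.

(* A simple graph on a finite type is its symmetric irreflexive set of ordered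
   adjacent pairs. *)
Section Trees.
Variable T : finType.

Definition adjacent (E : {set T * T}) : rel T := fun u v => (u, v) \in E.

Definition is_graph (E : {set T * T}) : Prop :=
  symmetric (adjacent E) /\ irreflexive (adjacent E).

Definition is_connected (E : {set T * T}) : Prop :=
  forall u v, connect (adjacent E) u v.

Definition is_acyclic (E : {set T * T}) : Prop :=
  forall c : seq T, uniq c -> (2 < size c)%N -> ~~ cycle (adjacent E) c.

Definition is_tree (E : {set T * T}) : Prop :=
  [/\ is_graph E, is_connected E & is_acyclic E].

End Trees.

(* The vertex set {1, ..., m} is relabelled as {0, ..., m - 1}. *)
Definition is_alternating (m : nat) (E : {set 'I_m * 'I_m}) : Prop :=
  forall v, (forall w, adjacent E v w -> (w < v)%N) \/
            (forall w, adjacent E v w -> (v < w)%N).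

Definition alternating_trees (m : nat) : nat :=
  #|[pred E : {set 'I_m * 'I_m} | `[< is_tree E /\ is_alternating E >]]|.

(* Series in two variables: in fps (fps rat) the outer variable is x and the
   inner one is y, so that F b r is the coefficient of x^b y^r. *)
Definition genA : fps (fps rat) :=
  let x : fps (fps rat) := fpsX in
  let y : fps (fps rat) := fpsC fpsX in
  let E := fps_exp (x * (1 + y)) in
  (1 + y * E) / (1 - y ^+ 2 * E).

Definition A_ (r : nat) : fps rat := Fps (fun b => genA b r).

(* Main.v *)
Require Import Defs.
From HB Require Import structures.
From mathcomp Require Import all_boot all_order all_algebra.
From mathcomp Require Import finmap ring zify.
From mathcomp Require Import boolp classical_sets reals.

(** Let [F] be the inverse of the series [G = f(- x)], where [f] is the
    exponential generating function of alternating trees.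

    Cutting the edge that joins the smallest vertex of a tree to the branch of
    its largest vertex gives [f' = (x (1 + f) / 2)' f], so that
    [G^2 exp (x (1 + G)) = 1].  Hence the denominator [1 - y^2 exp (x (1 + y))]
    of the double series [A] vanishes at [y = G = 1 / F].  It factors as
    [(1 - y F) (1 + y) U], where [U] is invertible with coefficients polynomial
    in [y]; therefore [A] and [1 + F' / (1 - y F)] differ by a series in [x]
    whose coefficients are polynomial in [y], i.e. [A_r = F' F^r] up to any
    given degree in [x] for [r] large.  This yields both limits.

    On the other hand [n! [x^n] A_r] counts the words [a] of length [n] over
    [{0, ..., r - 1}] with [a_i <> a_j + 1] for [i < j]: splitting such words at
    their last letter gives [A' = (A - 1) (1 + y A)] (derivative in [x]), which
    the double series [A] satisfies.  By Moebius inversion over the intersection poset, the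
    characteristic polynomial at an integer [q > n] counts the points of
    [(Z/q)^n] off the arrangement taken modulo [q]; rotating the last letter
    away, this is [q] times the number of words of length [n - 1] over [q - 1]
    letters.  Hence [chi_n(q) = n! [x^n] F^q] for large integers [q], because
    [(F^q)' = q F' F^(q - 1)], and so as polynomials. *)

Set Implicit Arguments.
Unset Strict Implicit.
Unset Printing Implicit Defensive.

Import Order.TTheory GRing.Theory Num.Theory.
Local Open Scope ring_scope.

(** * Calculus of formal power series *)

Section FpsMap.
Variables (R S : comNzRingType) (h : {rmorphism R -> S}).

Fact fps_map_is_zmod_morphism : zmod_morphism (fps_map h : fps R -> fps S).
Proof. by move=> f g; apply/fpsP => n; rewrite /= rmorphB. Qed.

Fact fps_map_is_monoid_morphism : monoid_morphism (fps_map h : fps R -> fps S).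
Proof.
split=> [|f g]; apply/fpsP => n.
  by rewrite fps_coef1 /= -fps_coefC fps_coef1 rmorph_nat.
by rewrite fps_coefM /= rmorph_sum; apply: eq_bigr => i _; rewrite rmorphM.
Qed.

HB.instance Definition _ := GRing.isZmodMorphism.Build (fps R) (fps S)
  (fps_map h) fps_map_is_zmod_morphism.
HB.instance Definition _ := GRing.isMonoidMorphism.Build (fps R) (fps S)
  (fps_map h) fps_map_is_monoid_morphism.

Lemma fps_map_C c : fps_map h (fpsC c) = fpsC (h c).
Proof. by apply/fpsP => n; rewrite /=; case: ifP => // _; rewrite rmorph0. Qed.

Lemma fps_map_X : fps_map h fpsX = fpsX.
Proof. by apply/fpsP => n; rewrite /= rmorph_nat. Qed.

End FpsMap.

Section FpsRingExtra.
Variable R : comNzRingType.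
Implicit Types (f g u : fps R) (c : nat -> R).

Fact fpsC_is_zmod_morphism : zmod_morphism (@fpsC R).
Proof. by move=> a b; apply/fpsP => -[|n] /=; rewrite ?subr0. Qed.

Fact fpsC_is_monoid_morphism : monoid_morphism (@fpsC R).
Proof.
split=> // a b; apply/fpsP => n; rewrite fps_coefCM !fps_coefC.
by case: ifP => // _; rewrite mulr0.
Qed.

HB.instance Definition _ := GRing.isZmodMorphism.Build R (fps R)
  (@fpsC R) fpsC_is_zmod_morphism.
HB.instance Definition _ := GRing.isMonoidMorphism.Build R (fps R)
  (@fpsC R) fpsC_is_monoid_morphism.

Lemma fps_coefXM f n : (fpsX * f) n.+1 = f n.
Proof.
rewrite fps_coefM !big_ord_recl /= mul0r add0r mul1r subSS subn0 big1 ?addr0 //.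
by move=> i _; rewrite mul0r.
Qed.

Lemma fps_coefXM0 f : (fpsX * f) 0%N = 0.
Proof. by rewrite fps_coef0M mul0r. Qed.

Lemma fps_coefMn f k n : (f *+ k) n = f n *+ k.
Proof. by elim: k => // k IHk; rewrite !mulrS fps_coefD IHk. Qed.

Lemma fps_coef_nat k n : (k%:R : fps R) n = if n == 0%N then k%:R else 0.
Proof. by rewrite fps_coefMn fps_coef1; case: eqP; rewrite ?mul0rn. Qed.

Lemma fps_coef0X u k : (u ^+ k) 0%N = u 0%N ^+ k.
Proof.
by elim: k => [|k IHk]; rewrite ?expr0 // !exprS fps_coef0M IHk.
Qed.

Definition fps_deriv f : fps R := Fps (fun n => f n.+1 *+ n.+1).

Fact fps_deriv_is_zmod_morphism : zmod_morphism fps_deriv.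
Proof. by move=> f g; apply/fpsP => n; rewrite /= mulrnBl. Qed.

HB.instance Definition _ := GRing.isZmodMorphism.Build (fps R) (fps R)
  fps_deriv fps_deriv_is_zmod_morphism.

Lemma fps_derivE f n : fps_deriv f n = f n.+1 *+ n.+1. Proof. by []. Qed.

Lemma fps_derivM f g :
  fps_deriv (f * g) = fps_deriv f * g + f * fps_deriv g.
Proof.
apply/fpsP => n; rewrite fps_derivE (fps_mul_trunc _ _ (leqnn n.+1)).
rewrite -coef_deriv derivM coefD; congr (_ + _); rewrite coefM fps_coefM;
  apply: eq_bigr => -[i /= le_in] _; rewrite coef_deriv !coef_fps_trunc //.
- by rewrite (leq_trans (leq_subr i n)).
- exact: ltnW.
- by rewrite ltnS leq_subr.
Qed.

Lemma fps_derivC (a : R) : fps_deriv (fpsC a) = 0.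
Proof. by apply/fpsP => n; rewrite fps_derivE /= mul0rn. Qed.

Lemma fps_deriv1 : fps_deriv 1 = 0. Proof. exact: fps_derivC. Qed.

Lemma fps_derivX : fps_deriv fpsX = 1.
Proof. by apply/fpsP => -[|n]; rewrite fps_derivE fps_coef1 //= mul0rn. Qed.

Lemma fps_derivXn u k : fps_deriv (u ^+ k) = u ^+ k.-1 * fps_deriv u *+ k.
Proof.
elim: k => [|k IHk]; first by rewrite expr0 fps_deriv1.
rewrite exprS fps_derivM IHk /= mulrS [fps_deriv u * _]mulrC; congr (_ + _).
by case: k {IHk} => [|k]; rewrite ?mulr0 //= mulrnAr mulrA -exprS.
Qed.

(* Meaningful as [\sum_k c k * u ^+ k] when u has zero constant term. *)
Definition fps_subst c u : fps R :=
  Fps (fun n => \sum_(k < n.+1) c k * (u ^+ k) n).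

Lemma fps_substE c u n : fps_subst c u n = \sum_(k < n.+1) c k * (u ^+ k) n.
Proof. by []. Qed.

Lemma fps_subst_widen c u n N : u 0%N = 0 -> (n <= N)%N ->
  fps_subst c u n = \sum_(k < N.+1) c k * (u ^+ k) n.
Proof.
move=> u0 le_nN; rewrite /= -!(big_mkord xpredT (fun k => c k * (u ^+ k) n)).
rewrite [RHS](@big_cat_nat _ _ _ n.+1) //= [X in _ = _ + X]big1_seq ?addr0 // => k.
rewrite mem_index_iota => /andP[_ /andP[lt_nk _]].
by rewrite fps_coef_exp_small ?mulr0.
Qed.

Lemma fps_coefM_subst f c u n : u 0%N = 0 ->
  (f * fps_subst c u) n = \sum_(k < n.+1) c k * (f * u ^+ k) n.
Proof.
move=> u0; rewrite fps_coefM.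
under eq_bigr => i _ do rewrite (fps_subst_widen _ u0 (leq_subr i n)) mulr_sumr.
rewrite exchange_big; apply: eq_bigr => k _; rewrite fps_coefM mulr_sumr.
by apply: eq_bigr => i _; rewrite mulrCA.
Qed.

Lemma fps_substS c u : u 0%N = 0 ->
  fps_subst c u = fpsC (c 0%N) + u * fps_subst (fun k => c k.+1) u.
Proof.
move=> u0; apply/fpsP => n; rewrite fps_coefD fps_coefM_subst //.
rewrite (fps_subst_widen _ u0 (leqnSn n)) big_ord_recl expr0; congr (_ + _).
  by rewrite fps_coef1 /=; case: eqP; rewrite ?mulr1 ?mulr0.
by apply: eq_bigr => k _; rewrite exprS.
Qed.

Lemma fps_deriv_subst c u : u 0%N = 0 ->
  fps_deriv (fps_subst c u) =
  fps_deriv u * fps_subst (fun k => c k.+1 *+ k.+1) u.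
Proof.
move=> u0; apply/fpsP => n; rewrite fps_coefM_subst // fps_derivE fps_substE -sumrMnl.
rewrite big_ord_recl expr0 fps_coef1 mulr0 mul0rn add0r.
apply: eq_bigr => k _; rewrite lift0 -mulrnAr [fps_deriv u * _]mulrC.
have -> : (u ^+ k.+1) n.+1 *+ n.+1 = fps_deriv (u ^+ k.+1) n by [].
rewrite fps_derivXn fps_coefMn mulrnAr mulrnAl.
by [].
Qed.

End FpsRingExtra.

Lemma fps_map_subst (R S : comNzRingType) (h : {rmorphism R -> S})
    (c : nat -> R) (u : fps R) :
  fps_map h (fps_subst c u) = fps_subst (h \o c) (fps_map h u).
Proof.
apply/fpsP => n; rewrite /= rmorph_sum; apply: eq_bigr => k _.
by rewrite rmorphM -rmorphXn.
Qed.

Lemma fps_map_deriv (R S : comNzRingType) (h : {rmorphism R -> S}) (f : fps R) :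
  fps_map h (fps_deriv f) = fps_deriv (fps_map h f).
Proof. by apply/fpsP => n; rewrite /= rmorphMn. Qed.

Section FpsExpLog.
Variable R : comUnitRingType.
Hypothesis natU : forall n, n.+1%:R \is a @GRing.unit R.
Implicit Types (f g u v : fps R).

Let factU n : n`!%:R \is a @GRing.unit R.
Proof. by case: n`! (fact_gt0 n). Qed.

Lemma fps_unitE f : (f \is a GRing.unit) = (f 0%N \is a GRing.unit).
Proof. by []. Qed.

(** The equation determines [n.+1] times the coefficient of degree [n.+1] from the lower ones, and
    [n.+1] is invertible. This is the tool for proving that two series are equal, over [rat], over
    polynomials in $q$ or $y$, and over series in $y$. *)
Lemma fps_linear_ode_uniq a f g :
    fps_deriv f = a * f -> fps_deriv g = a * g -> f 0%N = g 0%N ->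
  f = g.
Proof.
move=> df dg fg0; apply/fpsP; elim/ltn_ind=> -[//|n] IHn.
apply: (mulIr (natU n)); rewrite !mulr_natr -!fps_derivE df dg !fps_coefM.
by apply: eq_bigr => i _; rewrite IHn // ltnS leq_subr.
Qed.

Lemma fps_expE u : fps_exp u = fps_subst (fun k => k`!%:R^-1) u.
Proof. by apply/fpsP => n; apply: eq_bigr => k _; rewrite mulrC. Qed.

Lemma fps_exp_coef0 u : fps_exp u 0%N = 1.
Proof. by rewrite /= big_ord1 expr0 fps_coef1 divr1. Qed.

Lemma fps_deriv_exp u : u 0%N = 0 ->
  fps_deriv (fps_exp u) = fps_deriv u * fps_exp u.
Proof.
move=> u0; rewrite fps_expE fps_deriv_subst //; congr (_ * fps_subst _ _).
apply/funext => k; rewrite factS natrM invrM ?natU ?factU //.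
by rewrite -mulrnAr -[k.+1%:R^-1 *+ _]mulr_natr mulVr ?mulr1 ?natU.
Qed.

Lemma fps_expP u f : u 0%N = 0 -> fps_deriv f = fps_deriv u * f -> f 0%N = 1 ->
  f = fps_exp u.
Proof.
move=> u0 df f0; apply: (fps_linear_ode_uniq df); first exact: fps_deriv_exp.
by rewrite f0 fps_exp_coef0.
Qed.

Lemma fps_expD u v : u 0%N = 0 -> v 0%N = 0 ->
  fps_exp (u + v) = fps_exp u * fps_exp v.
Proof.
move=> u0 v0; symmetry; apply: fps_expP.
- by rewrite fps_coefD u0 v0 addr0.
- by rewrite fps_derivM !fps_deriv_exp // raddfD /=; ring.
- by rewrite fps_coef0M !fps_exp_coef0 mulr1.
Qed.

Lemma fps_exp0 : fps_exp (0 : fps R) = 1.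
Proof. by symmetry; apply: fps_expP => //; rewrite raddf0 mul0r fps_deriv1. Qed.

Lemma fps_exp_Mn u k : u 0%N = 0 -> fps_exp (u *+ k) = fps_exp u ^+ k.
Proof.
move=> u0; elim: k => [|k IHk]; first by rewrite fps_exp0.
by rewrite mulrS exprS fps_expD ?IHk // fps_coefMn u0 mul0rn.
Qed.

(** Here [psi] is $(e^u-1)/u$. Having $u$ as an explicit factor is what allows a linear factor to be
    split off the denominator of [genA]. *)
Lemma fps_exp_sub1 u : u 0%N = 0 -> exists psi, fps_exp u = 1 + u * psi.
Proof. by move=> u0; rewrite fps_expE fps_substS // invr1; eexists. Qed.

Lemma fps_logE f : fps_log f =
  fps_subst (fun k => if k is k'.+1 then (-1) ^+ k' / k%:R else 0) (f - 1).
Proof.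
apply/fpsP => n; rewrite /= big_ord_recl /= mul0r add0r big_add1 big_mkord.
by apply: eq_bigr => k _ /=; rewrite mulrAC.
Qed.

Lemma fps_log_coef0 f : fps_log f 0%N = 0.
Proof. by rewrite /= big_geq. Qed.

Lemma fps_deriv_log f : f 0%N = 1 -> fps_deriv (fps_log f) * f = fps_deriv f.
Proof.
move=> f0; have u0 : (f - 1) 0%N = 0 by rewrite fps_coefB f0 fps_coef1 subrr.
rewrite fps_logE fps_deriv_subst // raddfB /= fps_deriv1 subr0.
set c := (X in fps_subst X _); have {c}-> : c = (fun k => (-1) ^+ k).
  by apply/funext => k; rewrite /c -[LHS]mulr_natr divrK ?natU.
set g := fps_subst _ _; rewrite -mulrA [X in _ * X](_ : _ = 1) ?mulr1 //.
(* [g] is the geometric series of $1/(1+(f-1))$, and this is its functional equation. *)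
have geo : g = 1 - (f - 1) * g.
  rewrite {1}/g fps_substS //; congr (_ + _); rewrite -mulrN; congr (_ * _).
  apply/fpsP => n; rewrite fps_coefN !fps_substE -sumrN.
  by apply: eq_bigr => k _; rewrite exprS mulN1r mulNr.
have -> : g * f = g + (f - 1) * g by ring.
by rewrite {1}geo subrK.
Qed.

Lemma fps_exp_log f : f 0%N = 1 -> fps_exp (fps_log f) = f.
Proof.
move=> f0; symmetry; apply: fps_expP => //; first exact: fps_log_coef0.
by rewrite fps_deriv_log.
Qed.

Lemma fps_map_exp (S : comUnitRingType) (h : {rmorphism R -> S}) u :
  fps_map h (fps_exp u) = fps_exp (fps_map h u).
Proof.
rewrite fps_expE fps_map_subst; apply/fpsP => n; apply: eq_bigr => k _ /=.
by rewrite mulrC rmorphV ?factU // rmorph_nat.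
Qed.

Lemma fps_deriv_egf (a : nat -> R) :
  fps_deriv (egf a) = egf (fun n => a n.+1).
Proof.
apply/fpsP => n; rewrite fps_derivE /= factS natrM invrM ?natU ?factU //.
by rewrite mulrA -mulrnAr -[_^-1 *+ _]mulr_natr mulVr ?mulr1 ?natU.
Qed.

Lemma egf_coef (a : nat -> R) n : n`!%:R * egf a n = a n.
Proof. by rewrite /= mulrC divrK ?factU. Qed.

End FpsExpLog.

(** * The dominant pole of the double series *)

Lemma rat_natU n : n.+1%:R \is a @GRing.unit rat.
Proof. by rewrite unitfE pnatr_eq0. Qed.

Lemma poly_rat_natU n : n.+1%:R \is a @GRing.unit {poly rat}.
Proof. by rewrite -(rmorph_nat polyC) rmorph_unit ?rat_natU. Qed.

Lemma fps_rat_natU n : n.+1%:R \is a @GRing.unit (fps rat).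
Proof. by rewrite fps_unitE fps_coef_nat rat_natU. Qed.

Section FpsOfPoly.
Variable R : comNzRingType.

Definition fps_of_poly (p : {poly R}) : fps R := Fps (fun n => p`_n).

Fact fps_of_poly_is_zmod_morphism : zmod_morphism fps_of_poly.
Proof. by move=> p q; apply/fpsP => n; rewrite /= coefB. Qed.

Fact fps_of_poly_is_monoid_morphism : monoid_morphism fps_of_poly.
Proof.
split=> [|p q]; apply/fpsP => n; first by rewrite fps_coef1 /= coef1.
by rewrite fps_coefM /= coefM.
Qed.

HB.instance Definition _ := GRing.isZmodMorphism.Build {poly R} (fps R)
  fps_of_poly fps_of_poly_is_zmod_morphism.
HB.instance Definition _ := GRing.isMonoidMorphism.Build {poly R} (fps R)
  fps_of_poly fps_of_poly_is_monoid_morphism.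

Lemma fps_of_polyX : fps_of_poly 'X = fpsX.
Proof. by apply/fpsP => n; rewrite /= coefX. Qed.

Lemma fps_of_polyC c : fps_of_poly c%:P = fpsC c.
Proof. by apply/fpsP => n; rewrite /= coefC. Qed.

End FpsOfPoly.

Section DominantPole.
Variable G : fps rat.
Hypothesis G0 : G 0%N = 1.
Hypothesis G_eq : G ^+ 2 * fps_exp (fpsX * (1 + G)) = 1.

Let F := G^-1.

Let GU : G \is a GRing.unit. Proof. by rewrite fps_unitE G0. Qed.
Let FG : F * G = 1. Proof. exact: mulVr. Qed.
Let F0 : F 0%N = 1.
Proof. by move/fpsP/(_ 0%N): FG; rewrite fps_coef0M G0 mulr1. Qed.

Let x : fps {poly rat} := fpsX.
Let y : fps {poly rat} := fpsC 'X.
Let E : fps {poly rat} := fps_exp (x * (1 + y)).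
Let xser : {rmorphism fps rat -> fps {poly rat}} := fps_map polyC.

Let E_at_G : fps_exp (x * (1 + xser G)) = xser F ^+ 2.
Proof.
have xserX : xser fpsX = x by exact: fps_map_X.
have -> : x * (1 + xser G) = xser (fpsX * (1 + G)).
  by rewrite rmorphM rmorphD rmorph1 xserX.
rewrite -rmorphXn; transitivity (xser (fps_exp (fpsX * (1 + G)))).
  by symmetry; exact: (fps_map_exp rat_natU).
congr (xser _).
set e := fps_exp _; have -> : e = (F * G) ^+ 2 * e by rewrite FG expr1n mul1r.
by rewrite exprMn -mulrA G_eq mulr1.
Qed.

(** Since $e^{x(1+G)}=F^2$, the kernel is $1-y^2F^2e^{x(y-G)}$, which vanishes at $y=G$; this gives
    the factor $1-yF$. At $y=-1$ the exponent $x(1+y)$ is 0, so the kernel vanishes there too, which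
    gives the factor $1+y$. *)
Lemma kernel_factor : exists2 U : fps {poly rat}, U 0%N = 1 &
  1 - y ^+ 2 * E = (1 - y * xser F) * ((1 + y) * U).
Proof.
have x0 (f : fps {poly rat}) : (x * f) 0%N = 0 by rewrite fps_coefXM0.
have [psi psiE] := fps_exp_sub1 (x0 (y - xser G)).
(* The cofactor of $1-yF$: with $e^{x(y-G)}=1+x(y-G)\psi$ and $F(y-G)=-(1-yF)$, both $1-y^2F^2$ and
   the remaining term are multiples of $1-yF$. *)
pose V := 1 + y * xser F + xser F * y ^+ 2 * (x * psi).
have FGx : xser F * xser G = 1 by rewrite -rmorphM FG rmorph1.
have KV : 1 - y ^+ 2 * E = (1 - y * xser F) * V.
  have -> : E = fps_exp (x * (1 + xser G)) * fps_exp (x * (y - xser G)).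
    rewrite -(fps_expD poly_rat_natU (x0 _) (x0 _)) /E.
    by congr fps_exp; ring.
  rewrite psiE E_at_G.
  have -> : (1 - y * xser F) * V = 1 - y ^+ 2 * xser F ^+ 2
      * (1 + x * y * psi) + y ^+ 2 * xser F * 1 * (x * psi).
    by rewrite /V; ring.
  by rewrite -FGx; ring.
(* Evaluation at $y=-1$, possible because coefficients are kept polynomial in $y$. There the kernel
   is 0 while $1+F$ is invertible, so [V] vanishes. *)
pose ev : {rmorphism fps {poly rat} -> fps rat} := fps_map (horner_eval (-1 : rat)).
have evF : ev (xser F) = F.
  by apply/fpsP => n; rewrite /= /horner_eval hornerC.
have evy : ev y = -1.
  have X1 : horner_eval (-1 : rat) 'X = -1 by exact: hornerX.
  transitivity (fpsC (horner_eval (-1 : rat) 'X)); first exact: fps_map_C.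
  by rewrite X1 rmorphN rmorph1.
have evexp u : ev (fps_exp u) = fps_exp (ev u).
  exact: (fps_map_exp poly_rat_natU).
have evV : ev V = 0.
  have : (1 + F) * ev V = 0.
    have -> : 1 + F = ev (1 - y * xser F).
      by rewrite rmorphB rmorphM rmorph1 evy evF; ring.
    rewrite -rmorphM -KV rmorphB rmorph1 rmorphM rmorphXn evy evexp.
    rewrite rmorphM rmorphD rmorph1 evy.
    by rewrite addrN mulr0 (fps_exp0 rat_natU); ring.
  have FU : 1 + F \is a GRing.unit by rewrite fps_unitE fps_coefD F0.
  by move/(congr1 ( *%R (1 + F)^-1)); rewrite mulKr // mulr0.
(* Coefficientwise division by $1+y$, exact because every coefficient of [V] has the root $-1$. *)
pose U := Fps (fun n => V n %/ ('X - (-1)%:P)).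
have VU : V = (1 + y) * U.
  have -> : 1 + y = fpsC ('X - (-1)%:P).
    by rewrite rmorphB addrC /= !rmorphN !rmorph1 opprK.
  apply/fpsP => n; rewrite fps_coefCM mulrC /= divpK //.
  by rewrite dvdp_XsubCl; apply/eqP; move/fpsP/(_ n): evV.
exists U; last by rewrite KV VU.
have nz1X : ('X - (-1)%:P : {poly rat}) != 0 by rewrite polyXsubC_eq0.
apply: (mulfI nz1X); rewrite mulr1.
have -> : ('X - (-1)%:P) * U 0%N = V 0%N.
  rewrite VU fps_coef0M fps_coefD fps_coef1 /=; congr (_ * _).
  by rewrite addrC rmorphN rmorph1 opprK.
rewrite /V !fps_coefD !fps_coef0M /= F0 mul0r mulr0 addr0 mulr1 addrC.
by rewrite rmorphN rmorph1 opprK.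
Qed.

(** Forgets that the coefficients in $x$ are polynomial in $y$. What lies in its image has, in each
    degree in $x$, only finitely many powers of $y$. *)
Let toxy : {rmorphism fps {poly rat} -> fps (fps rat)} :=
  fps_map (@fps_of_poly rat).
Let Y : fps (fps rat) := fpsC fpsX.

Let toxy_y : toxy y = Y.
Proof.
by transitivity (fpsC (fps_of_poly ('X : {poly rat})));
  [exact: fps_map_C | rewrite fps_of_polyX].
Qed.

Let toxy_x : toxy x = fpsX. Proof. exact: fps_map_X. Qed.

Let toxy_exp u : toxy (fps_exp u) = fps_exp (toxy u).
Proof. exact: (fps_map_exp poly_rat_natU). Qed.

Let toxy_deriv f : toxy (fps_deriv f) = fps_deriv (toxy f).
Proof. exact: fps_map_deriv. Qed.

Let toxyE : toxy E = fps_exp (fpsX * (1 + Y)).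
Proof. by rewrite toxy_exp rmorphM rmorphD rmorph1 toxy_y toxy_x. Qed.

Let toxy_yE : toxy (y * E) = Y * fps_exp (fpsX * (1 + Y)).
Proof. by rewrite rmorphM toxy_y toxyE. Qed.

Let toxy_y2E : toxy (y ^+ 2 * E) = Y ^+ 2 * fps_exp (fpsX * (1 + Y)).
Proof. by rewrite rmorphM rmorphXn toxy_y toxyE. Qed.

Lemma genA_eq : genA * (1 - toxy (y ^+ 2 * E)) = 1 + toxy (y * E).
Proof.
rewrite toxy_yE toxy_y2E /genA divrK // fps_unitE fps_coefB fps_coef0M fps_exp_coef0 mulr1.
by rewrite fps_unitE fps_coefB !fps_coef0M mul0r subr0.
Qed.

(* The double series [F' / (1 - y F)], which carries the pole of [genA] that
   dominates as the exponent of [y] grows. *)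
Definition pole_part : fps (fps rat) :=
  Fps (fun b => Fps (fun r => (fps_deriv F * F ^+ r) b)).

Let coefYM f b r : (Y * f) b r.+1 = f b r.
Proof. by rewrite fps_coefCM fps_coefXM. Qed.

Let coefYM0 f b : (Y * f) b 0%N = 0.
Proof. by rewrite fps_coefCM fps_coefXM0. Qed.

Lemma pole_partE :
  (1 - Y * toxy (xser F)) * pole_part = toxy (xser (fps_deriv F)).
Proof.
have txE (f : fps rat) n : toxy (xser f) n = fpsC (f n).
  exact: fps_of_polyC.
have FH : toxy (xser F) * pole_part =
    Fps (fun b => Fps (fun r => (fps_deriv F * F ^+ r.+1) b)).
  apply/fpsP => b; apply/fpsP => r; rewrite fps_coefM fps_coef_sum.
  transitivity ((fps_deriv F * F ^+ r.+1) b); last by [].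
  rewrite exprS mulrCA fps_coefM; apply: eq_bigr => i _.
  by rewrite txE fps_coefCM.
rewrite mulrBl mul1r -mulrA FH; apply/fpsP => b; apply/fpsP => r.
transitivity (pole_part b r -
    (Y * Fps (fun b => Fps (fun r => (fps_deriv F * F ^+ r.+1) b))) b r).
  by [].
rewrite txE; case: r => [|r]; last by rewrite coefYM subrr.
rewrite coefYM0 subr0 -[LHS]/((fps_deriv F * F ^+ 0) b) expr0.
by rewrite mulr1.
Qed.

(** Let $Z=1+yA$ and $p=1-yF$. Then $Z=(1+y)/K=1/(pu)$ for the kernel $K$, and the differential
    equation of $K$ shows that $y(A-1)$ is minus the logarithmic derivative of $pu$. The factor $p$
    contributes $yF'/(1-yF)$, which is $y$ times [pole_part], and $u$ contributes $-u'/u$. *)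
Lemma genA_pole_part : exists Q : fps {poly rat},
  Y * (genA - 1 - pole_part) = toxy Q.
Proof.
have [U U0 KU] := kernel_factor.
have UU : U \is a GRing.unit by rewrite fps_unitE U0 unitr1.
(* The quotient is taken before applying [toxy]: [U] has constant term 1, so its inverse still has
   coefficients polynomial in $y$. *)
exists (- fps_deriv U / U).
pose u := toxy U; pose Fx := toxy (xser F); pose K := 1 - toxy (y ^+ 2 * E).
pose Z := 1 + Y * genA; pose p := 1 - Y * Fx.
have Y0 : (1 + Y) 0%N = 1 + fpsX by [].
have YU : 1 + Y \is a GRing.unit by rewrite fps_unitE Y0 fps_unitE fps_coefD.
have uU : u \is a GRing.unit by apply: rmorph_unit.
have F'E : toxy (xser (fps_deriv F)) = fps_deriv Fx.
  by rewrite -toxy_deriv; congr (toxy _); exact: fps_map_deriv.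
have pU : p \is a GRing.unit.
  rewrite fps_unitE fps_coefB fps_coef0M fps_unitE fps_coefB fps_coef0M.
  by rewrite mul0r subr0.
have Kpu : K = p * ((1 + Y) * u).
  have -> : K = toxy (1 - y ^+ 2 * E) by rewrite rmorphB rmorph1.
  by rewrite KU !rmorphM rmorphB rmorphD !rmorph1 rmorphM toxy_y.
have ZK : Z * K = 1 + Y.
  rewrite /Z mulrDl mul1r -mulrA [genA * K]genA_eq /K toxy_yE toxy_y2E.
  by ring.
have Zpu : Z * (p * u) = 1.
  apply: (mulIr YU); rewrite mul1r -[RHS]ZK Kpu; ring.
have Y' : fps_deriv Y = 0 by exact: fps_derivC.
have d1Y : fps_deriv (1 + Y) = 0.
  by rewrite (raddfD (@fps_deriv _)) /= fps_deriv1 Y' addr0.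
have K' : fps_deriv K = (1 + Y) * (K - 1).
  rewrite /K toxy_y2E.
  set e := fps_exp _.
  have e' : fps_deriv e = (1 + Y) * e.
    rewrite fps_deriv_exp ?fps_coefXM0 //; last exact: fps_rat_natU.
    by rewrite fps_derivM fps_derivX d1Y mulr0 addr0 mul1r.
  rewrite raddfB /= fps_deriv1 fps_derivM e' fps_derivXn Y'.
  by ring.
have Z'K : fps_deriv Z * K = Z * (1 + Y) * (1 - K).
  have /(congr1 (@fps_deriv _)) := ZK.
  rewrite fps_derivM K' d1Y => /eqP.
  by rewrite addr_eq0 => /eqP->; ring.
have Z' : fps_deriv Z * (p * u) = Z - (1 + Y).
  apply: (mulIr YU); have -> : fps_deriv Z * (p * u) * (1 + Y) = fps_deriv Z * K.
    by rewrite Kpu; ring.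
  rewrite Z'K Kpu; have -> : Z * (1 + Y) * (1 - p * ((1 + Y) * u)) =
    Z * (1 + Y) - Z * (p * u) * (1 + Y) * (1 + Y) by ring.
  by rewrite Zpu; ring.
have p' : fps_deriv p = - (Y * fps_deriv Fx).
  by rewrite /p raddfB /= fps_deriv1 sub0r fps_derivM Y' mul0r add0r.
have pu' : Z * fps_deriv (p * u) = (1 + Y) - Z.
  have /(congr1 (@fps_deriv _)) := Zpu.
  rewrite fps_derivM fps_deriv1 Z' => /eqP; rewrite addrC addr_eq0 => /eqP->.
  by rewrite opprB.
have main : (Z - 1 - Y) * (p * u) = Y * fps_deriv Fx * u - p * fps_deriv u.
  have -> : Z - 1 - Y = - (Z * fps_deriv (p * u)) by rewrite pu'; ring.
  rewrite fps_derivM p'; set w := (X in Z * X).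
  have -> : - (Z * w) * (p * u) = - (Z * (p * u) * w) by ring.
  by rewrite Zpu /w; ring.
have pH : p * pole_part = fps_deriv Fx by rewrite pole_partE.
rewrite rmorphM rmorphN rmorphV // toxy_deriv -/u.
apply: (mulIr uU); rewrite divrK //; apply: (mulIr pU).
have -> : Y * (genA - 1 - pole_part) * u * p =
    (Z - 1 - Y) * (p * u) - Y * (p * pole_part) * u by rewrite /Z; ring.
by rewrite main pH; ring.
Qed.

Lemma A_eventually b : exists N, forall r, (N <= r)%N ->
  A_ r b = (fps_deriv F * F ^+ r) b.
Proof.
(* Beyond the size of the polynomial [Q b] its coefficients vanish. The index [r.+2] below accounts
   for the factor $y$, and positive exponents of $y$ avoid the subtracted 1. *)
have [Q QE] := genA_pole_part; exists (size (Q b)).+1 => -[//|r] lt_r.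
move/fpsP/(_ b)/fpsP/(_ r.+2): QE.
rewrite coefYM => e.
have : A_ r.+1 b - (fps_deriv F * F ^+ r.+1) b = (Q b)`_r.+2.
  rewrite -[RHS]/(toxy Q b r.+2) -e !fps_coefB fps_coef1.
  by case: (b == 0%N); rewrite ?fps_coef1 subr0.
by rewrite nth_default ?(leq_trans _ (leqnSn _)) // => /eqP; rewrite subr_eq0 => /eqP.
Qed.

End DominantPole.

(** * Words avoiding the hyperplanes *)

Section WordCount.
Variable T : eqType.
Implicit Types (X s t : seq T) (Q : pred (seq T)).

(** Counts words of length [n] over the alphabet [X]. Summing over first letters, instead of taking
    a cardinal, makes restricting, permuting and renaming the alphabet plain inductions. *)
Fixpoint wcount X (n : nat) Q : nat :=
  if n is n'.+1 then (\sum_(u <- X) wcount X n' (Q \o cons u))%N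
  else Q [::].

Lemma eq_wcount X n Q Q' : (forall t, all (mem X) t -> Q t = Q' t) ->
  wcount X n Q = wcount X n Q'.
Proof.
elim: n Q Q' => [|n IHn] Q Q' eqQ /=; first by rewrite eqQ.
apply: eq_big_seq => u Xu.
by apply: IHn => t Xt /=; apply: eqQ; rewrite /= Xt andbT.
Qed.

Lemma perm_wcount X X' n Q : perm_eq X X' -> wcount X n Q = wcount X' n Q.
Proof.
move=> eqX; elim: n Q => //= n IHn Q.
by rewrite (perm_big _ eqX); apply: eq_bigr => u _; rewrite IHn.
Qed.

Lemma wcount_pred0 X n Q : Q =1 xpred0 -> wcount X n Q = 0%N.
Proof.
elim: n Q => [|n IHn] Q Q0 /=; first by rewrite Q0.
by rewrite big1 // => u _; apply: IHn => t /=; apply: Q0.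
Qed.

Lemma wcount_filter (b : pred T) X n Q :
  wcount X n (fun t => all b t && Q t) = wcount (filter b X) n Q.
Proof.
elim: n Q => [|n IHn] Q //=; rewrite big_filter [LHS](bigID b) /=.
rewrite [X in (_ + X)%N]big1 ?addn0 => [|u nbu]; last first.
  by apply: wcount_pred0 => t /=; rewrite (negPf nbu).
apply: eq_bigr => u bu; rewrite -IHn; apply: eq_wcount => t _ /=.
by rewrite bu.
Qed.

Lemma wcount_rcons X n Q :
  wcount X n.+1 Q = (\sum_(p <- X) wcount X n (fun t => Q (rcons t p)))%N.
Proof.
elim: n Q => [|n IHn] Q //; rewrite [LHS]/=.
under eq_bigr => u _ do rewrite -/(wcount X n.+1 (Q \o cons u)) IHn.
by rewrite exchange_big.
Qed.

End WordCount.

Lemma wcount_map (T S : eqType) (f : T -> S) X n Q :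
  wcount (map f X) n Q = wcount X n (Q \o map f).
Proof.
by elim: n Q => //= n IHn Q; rewrite big_map; apply: eq_bigr => u _; apply: IHn.
Qed.

Definition wgf (T : eqType) (X : seq T) Q : fps rat :=
  egf (fun n => (wcount X n Q)%:R).

Lemma wgf_deriv (T : eqType) (X : seq T) Q :
  fps_deriv (wgf X Q) = \sum_(u <- X) wgf X (Q \o cons u).
Proof.
rewrite (fps_deriv_egf rat_natU); apply/fpsP => n; rewrite fps_coef_sum /=.
by rewrite natr_sum mulr_suml.
Qed.

(* A word is a shuffle of its subwords in [a] and outside [a]; the binomial
   coefficient counting shuffles is absorbed by the product of exponential
   generating functions. *)
Lemma wgf_shuffle (T : eqType) (a : pred T) (X : seq T) Q1 Q2 :
  wgf X (fun t => Q1 (filter a t) && Q2 (filter (predC a) t)) =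
  wgf (filter a X) Q1 * wgf (filter (predC a) X) Q2.
Proof.
apply/fpsP => n; elim: n Q1 Q2 => [|n IHn] Q1 Q2.
  by rewrite fps_coef0M /= !divr1; do 2!case: (_ [::]); rewrite ?mulr0.
(* Differentiation removes the first letter, which lies in exactly one of the two alphabets; this
   matches the product rule. *)
apply: (mulIr (rat_natU n)); rewrite !mulr_natr -!fps_derivE fps_derivM.
rewrite !wgf_deriv mulr_suml mulr_sumr fps_coefD !fps_coef_sum !big_filter.
rewrite (bigID a); congr (_ + _); apply: eq_bigr => u au; rewrite -IHn; rewrite andTb in au.
  by congr (_%:R / _); apply: eq_wcount => t _ /=; rewrite au.
by congr (_%:R / _); apply: eq_wcount => t _ /=; rewrite (negPf au).
Qed.

Definition linial_word (s : seq nat) : bool := pairwise (fun u v => u != v.+1) s.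

Lemma linial_word_shift k s : linial_word (map (addn k) s) = linial_word s.
Proof.
rewrite /linial_word pairwise_map; apply: eq_pairwise => u v /=.
by rewrite -addnS eqn_add2l.
Qed.

(** A forbidden pair consists of consecutive values; if it straddles the cut above [p], its larger
    letter is [p.+1], which is excluded. *)
Lemma linial_word_split p s : all (fun u => u != p.+1) s ->
  linial_word s = linial_word (filter (geq p) s) &&
                  linial_word (filter (predC (geq p)) s).
Proof.
elim: s => //= u s IHs /andP[up sp].
rewrite IHs // /linial_word; case: (leqP u p) => le_up /=; last first.
  rewrite andbCA; congr (_ && (_ && _)); rewrite all_filter.
  apply: eq_in_all => v sv /=; rewrite -ltnNge.
  case: (leqP v p) => //= le_vp; apply/eqP => uv; move: up le_up.
  by rewrite uv eqSS ltnS; case: ltngtP le_vp.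
rewrite -andbA; congr (_ && _); rewrite all_filter.
apply: eq_in_all => v sv /=; case: (leqP v p) => //= lt_pv.
by apply/eqP => uv; move: (leq_trans le_up (ltnW lt_pv)); rewrite uv ltnn.
Qed.

Definition linial_gf (r : nat) : fps rat := wgf (iota 0 r) linial_word.

(* Splitting a word at its last letter [p]: the letters [<= p] and the letters
   [>= p + 2] are independent of each other, and [p + 1] does not occur. *)
Lemma linial_gf_deriv r : fps_deriv (linial_gf r) =
  \sum_(p < r) linial_gf p.+1 * linial_gf (r - p.+2).
Proof.
rewrite (fps_deriv_egf rat_natU); apply/fpsP => n; rewrite fps_coef_sum.
rewrite -(big_mkord xpredT (fun p => (linial_gf p.+1 * linial_gf (r - p.+2)) n)).
rewrite [LHS]/= -/(wcount _ n.+1 _) wcount_rcons natr_sum mulr_suml.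
rewrite /index_iota subn0; apply: eq_big_seq => p.
rewrite mem_iota add0n => /andP[_ lt_pr].
(* A last letter [p] forbids [p.+1] before it, a condition on the letters above [p] only. *)
transitivity (wgf (iota 0 r) (fun t => linial_word (filter (geq p) t) &&
  (all (fun u => u != p.+1) (filter (predC (geq p)) t) &&
   linial_word (filter (predC (geq p)) t))) n).
  congr (_%:R / _); apply: eq_wcount => t _.
  rewrite [LHS]/linial_word pairwise_rcons -/(linial_word t).
  have -> : all (fun u => u != p.+1) [seq x <- t | predC (geq p) x]
            = all (fun u => u != p.+1) t.
    rewrite all_filter; apply: eq_all => u /=; rewrite -ltnNge.
    by case: (ltnP p u) => //= le_up; rewrite neq_ltn ltnS le_up.
  rewrite [RHS]andbCA; case: (boolP (all _ t)) => //= tp.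
  exact: linial_word_split.
rewrite (wgf_shuffle (geq p) _ linial_word
  (fun s => all (fun u => u != p.+1) s && linial_word s)).
congr ((_ * _ : fps rat) n).
  congr (egf _); apply/funext => k; congr (wcount _ _ _)%:R.
  rewrite -(subnKC lt_pr) iotaD filter_cat add0n.
  rewrite (@eq_in_filter _ _ xpredT) ?filter_predT => [|u]; last first.
    by rewrite mem_iota add0n ltnS.
  rewrite (@eq_in_filter _ _ xpred0) ?filter_pred0 ?cats0 // => u.
  by rewrite mem_iota ltnNge => /andP[/negPf].
apply/fpsP => k; rewrite /linial_gf /wgf /=; congr (_%:R / _).
rewrite wcount_filter.
(* The remaining large letters are the translate by [p.+2] of an initial segment; for [p] equal to
   [r.-1] the truncated subtraction correctly yields the empty alphabet. *)
have -> : [seq u <- [seq u <- iota 0 r | predC (geq p) u] | u != p.+1] =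
    map (addn p.+2) (iota 0 (r - p.+2)).
  rewrite -{1}(subnKC lt_pr) iotaD !filter_cat add0n.
  rewrite [X in filter _ X ++ _](@eq_in_filter _ _ xpred0); last first.
    by move=> u; rewrite mem_iota add0n ltnS /= => ->.
  rewrite filter_pred0 /= (subnS r p.+1) -iotaDl addn0.
  case: (r - p.+1)%N => //= m; rewrite ltnn /= eqxx /= -filter_predI.
  rewrite (@eq_in_filter _ _ xpredT) ?filter_predT // => u.
  rewrite mem_iota => /andP[lt_pu _] /=.
  by rewrite neq_ltn lt_pu orbT -ltnNge (ltn_trans _ lt_pu).
rewrite wcount_map; apply: eq_wcount => t _ /=.
by rewrite linial_word_shift.
Qed.

Lemma linial_gf_coef0 r : linial_gf r 0%N = 1.
Proof. by rewrite /= divr1. Qed.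

Lemma linial_gf0 : linial_gf 0 = 1.
Proof.
apply/fpsP => -[|n]; first by rewrite linial_gf_coef0.
by rewrite fps_coef1 /= big_nil mul0r.
Qed.

Section LinialDoubleSeries.

Let y : fps (fps rat) := fpsC fpsX.

Let coef_yM (f : fps (fps rat)) b r : (y * f) b r.+1 = f b r.
Proof. by rewrite fps_coefCM fps_coefXM. Qed.

Let coef_yM0 (f : fps (fps rat)) b : (y * f) b 0%N = 0.
Proof. by rewrite fps_coefCM fps_coefXM0. Qed.

Definition linial_gf2 : fps (fps rat) :=
  Fps (fun b => Fps (fun r => linial_gf r b)).

(** Products in $y$ convolve alphabet sizes. Subtracting 1 drops the empty alphabet, as [p.+1] is
    positive, and [1 + y * linial_gf2] has the coefficients [linial_gf j.-1], where [j] equal to 0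
    gives the series 1 of the empty alphabet. *)
Lemma linial_gf2_deriv :
  fps_deriv linial_gf2 = (linial_gf2 - 1) * (1 + y * linial_gf2).
Proof.
apply/fpsP => b; apply/fpsP => r.
have -> : fps_deriv linial_gf2 b r = fps_deriv (linial_gf r) b.
  by rewrite fps_derivE fps_coefMn.
have coef2 (f g : fps (fps rat)) : (f * g) b r =
    \sum_(j < r.+1) \sum_(i < b.+1) f i j * g (b - i)%N (r - j)%N.
  by rewrite fps_coefM fps_coef_sum exchange_big.
have L1 i j : (linial_gf2 - 1) i j.+1 = linial_gf j.+1 i.
  rewrite !fps_coefB fps_coef1 -[RHS]subr0; congr (_ - _).
  by case: (i == 0%N).
have L10 i : (linial_gf2 - 1) i 0%N = 0.
  rewrite !fps_coefB -[linial_gf2 i 0%N]/(linial_gf 0 i) linial_gf0 !fps_coef1.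
  by case: (i == 0%N); rewrite subrr.
have L2 i j : (1 + y * linial_gf2) i j = linial_gf j.-1 i.
  rewrite !fps_coefD fps_coef1; case: j => [|j].
    rewrite coef_yM0 addr0 linial_gf0 fps_coef1.
    by case: (i == 0%N).
  rewrite coef_yM [X in X + _](_ : _ = 0) ?add0r //.
  by case: (i == 0%N).
rewrite coef2 linial_gf_deriv fps_coef_sum big_ord_recl [X in _ = X + _]big1 ?add0r;
  last first.
  by move=> i _; rewrite L10 mul0r.
apply: eq_bigr => p _; rewrite fps_coefM; apply: eq_bigr => i _.
by rewrite lift0 L1 L2 -subnS.
Qed.

(** With $e'=(1+y)e$ and $K=1-y^2e$, both sides multiplied by $K$ equal $y(1+y)e(1+yA)$. *)
Lemma genA_deriv : fps_deriv genA = (genA - 1) * (1 + y * genA).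
Proof.
pose e : fps (fps rat) := fps_exp (fpsX * (1 + y)).
have y' : fps_deriv y = 0 by exact: fps_derivC.
have e' : fps_deriv e = (1 + y) * e.
  rewrite (fps_deriv_exp fps_rat_natU) ?fps_coefXM0 //.
  rewrite fps_derivM fps_derivX (raddfD (@fps_deriv _)) /= fps_deriv1 y'.
  by rewrite addr0 mulr0 addr0 mul1r.
pose K := 1 - y ^+ 2 * e.
have KU : K \is a GRing.unit.
  rewrite fps_unitE fps_coefB fps_coef0M fps_exp_coef0 mulr1.
  by rewrite fps_unitE fps_coefB !fps_coef0M mul0r subr0.
have AK : genA * K = 1 + y * e by rewrite /genA divrK.
have A'K : fps_deriv genA * K = y * (1 + y) * e * (1 + y * genA).
  have /(congr1 (@fps_deriv _)) := AK; rewrite fps_derivM.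
  rewrite (raddfB (@fps_deriv _)) (raddfD (@fps_deriv _)) /= !fps_deriv1.
  rewrite !fps_derivM e' y' => /eqP; rewrite -subr_eq0 => /eqP A'K.
  by apply/eqP; rewrite -subr_eq0 -A'K; apply/eqP; ring.
apply: (mulIr KU); rewrite A'K.
have -> : (genA - 1) * (1 + y * genA) * K =
  (genA * K - K) * (1 + y * genA) by ring.
by rewrite AK /K; ring.
Qed.

(** Both series solve the same Riccati equation, so their difference solves a linear one with
    coefficient [a]. At $x=0$ both are $1/(1-y)$, because $(1+y)/(1-y^2)=1/(1-y)$ and there is one
    empty word over each alphabet. *)
Lemma genA_linial_gf2 : genA = linial_gf2.
Proof.
apply/eqP; rewrite -subr_eq0; apply/eqP.
pose a := 1 + y * linial_gf2 + (genA - 1) * y.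
apply: (@fps_linear_ode_uniq _ fps_rat_natU a).
- rewrite (raddfB (@fps_deriv _)) /= genA_deriv linial_gf2_deriv /a.
  by ring.
- by rewrite (raddf0 (@fps_deriv _)) mulr0.
rewrite fps_coefB; apply/eqP; rewrite subr_eq0; apply/eqP.
have e0 : genA 0%N * (1 - fpsX ^+ 2) = 1 + fpsX.
  have -> : 1 - fpsX ^+ 2 = (1 - y ^+ 2 * fps_exp (fpsX * (1 + y))) 0%N.
    by rewrite fps_coefB !fps_coef0M fps_exp_coef0 mulr1.
  rewrite -fps_coef0M /genA divrK.
    by rewrite fps_coefD fps_coef0M fps_exp_coef0 mulr1.
  rewrite fps_unitE fps_coefB fps_coef0M fps_exp_coef0 mulr1.
  by rewrite fps_unitE fps_coefB !fps_coef0M mul0r subr0.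
have L0 : linial_gf2 0%N * (1 - fpsX) = 1.
  apply/fpsP => -[|r]; first
    by rewrite fps_coef0M -[X in X * _]/(linial_gf 0 0%N) linial_gf_coef0
       mul1r fps_coefB subr0.
  rewrite mulrBr mulr1 fps_coefB mulrC fps_coefXM fps_coef1.
  have L0r k : linial_gf2 0%N k = 1 by apply: linial_gf_coef0.
  by rewrite !L0r subrr.
have XU : 1 - fpsX ^+ 2 \is a @GRing.unit (fps rat).
  by rewrite fps_unitE fps_coefB fps_coef0M mul0r subr0.
apply: (mulIr XU); rewrite e0.
have -> : linial_gf2 0%N * (1 - fpsX ^+ 2) =
  (linial_gf2 0%N * (1 - fpsX)) * (1 + fpsX) by ring.
by rewrite L0 mul1r.
Qed.

Lemma A_linial_gf r : A_ r = linial_gf r.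
Proof. by apply/fpsP => b; rewrite /A_ genA_linial_gf2. Qed.

End LinialDoubleSeries.

(** * Words over the residues modulo $q$ *)

Definition cyclic_word (q : nat) (s : seq nat) : bool :=
  pairwise (fun u v => u != v.+1 %% q)%N s.

(* By rotation, the last letter [p] of a cyclic word may be taken to be [q - 2],
   so that [p + 1], which does not occur elsewhere, becomes [q - 1]. *)
Lemma cyclic_wcount q n :
  wcount (iota 0 q) n.+1 (cyclic_word q) =
  (q * wcount (iota 0 q.-1) n linial_word)%N.
Proof.
rewrite wcount_rcons; set N := wcount (iota 0 q.-1) n linial_word.
transitivity (\sum_(p <- iota 0 q) N)%N; last first.
  by rewrite big_const_seq count_predT size_iota iter_addn_0 mulnC.
apply: eq_big_seq => p; rewrite mem_iota add0n => /andP[_ lt_pq].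
have q0 : (0 < q)%N by apply: leq_trans lt_pq.
(* This rotation carries [q.-1] to the residue of [p.+1], which the last letter forbids. *)
pose f u := ((u + p.+2) %% q)%N.
have f_inj : {in iota 0 q &, injective f}.
  move=> u v; rewrite !mem_iota !add0n /= => lt_uq lt_vq /eqP.
  by rewrite eqn_modDr !modn_small // => /eqP.
have perm_f : perm_eq (map f (iota 0 q)) (iota 0 q).
  have f_uniq : uniq (map f (iota 0 q)) by rewrite map_inj_in_uniq ?iota_uniq.
  apply: uniq_perm; rewrite ?iota_uniq //.
  apply: (uniq_min_size f_uniq _ _).2; last by rewrite size_map.
  by move=> _ /mapP[u _ ->]; rewrite mem_iota add0n /= ltn_mod.
rewrite -(perm_wcount _ _ perm_f) wcount_map.
rewrite /N; have -> : iota 0 q.-1 = filter (fun u => u != q.-1) (iota 0 q).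
  rewrite -{3}(prednK q0) -addn1 iotaD filter_cat /= add0n eqxx cats0.
  rewrite (@eq_in_filter _ _ xpredT) ?filter_predT // => u.
  by rewrite mem_iota add0n => /andP[_ /ltn_eqF->].
rewrite -wcount_filter; apply: eq_wcount => t /allP tq.
rewrite /cyclic_word /= pairwise_rcons pairwise_map all_map.
have f_top u : u \in t -> (f u != p.+1 %% q)%N = (u != q.-1).
  move/tq; rewrite inE mem_iota add0n /= => lt_uq; congr (~~ _).
  rewrite /f addnS -addSn -[X in _ == X %[mod _]]add0n eqn_modDr mod0n.
  rewrite -[RHS]eqSS (prednK q0); move: lt_uq; rewrite leq_eqVlt => /predU1P[->|lt_uq].
    by rewrite modnn !eqxx.
  by rewrite modn_small // (ltn_eqF lt_uq).
rewrite (eq_in_all f_top); case: (boolP (all _ t)) => //= /allP t_top.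
(* Without the letter [q.-1] no successor wraps around, so the cyclic condition becomes the linear
   one. *)
apply: (@eq_in_pairwise _ (mem t)); last exact: allss.
move=> u v ut vt /=; congr (~~ _).
have lt_uq : (u < q)%N by have := tq u ut; rewrite inE mem_iota.
have lt_vq : (v.+1 < q)%N.
  rewrite -(prednK q0) ltnS ltn_neqAle t_top //= -ltnS (prednK q0).
  by have := tq v vt; rewrite inE mem_iota.
rewrite /f -[(_ %% _).+1]addn1 modnDml addn1 -addSn eqn_modDr.
by rewrite (modn_small lt_uq) (modn_small lt_vq).
Qed.

Lemma big_cons_tuple (T : finType) n (F : seq T -> nat) :
  (\sum_(t : n.+1.-tuple T) F t = \sum_(u : T) \sum_(t : n.-tuple T) F (u :: t))%N.
Proof.
rewrite pair_big /= (reindex (fun p : T * n.-tuple T => cons_tuple p.1 p.2)) //.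
exists (fun t => (thead t, [tuple of behead t])) => [[u t] _|t _] /=.
  by congr (_, _); apply: val_inj.
by rewrite [RHS]tuple_eta.
Qed.

Lemma wcount_tuple q n (Q : pred (seq nat)) :
  wcount (iota 0 q) n Q = (\sum_(t : n.-tuple 'I_q) Q (map val t))%N.
Proof.
elim: n Q => [|n IHn] Q.
  rewrite (big_pred1 [tuple]) //= => t.
  by rewrite (tuple0 t) /= eqxx.
rewrite (big_cons_tuple _ (fun t : seq 'I_q => nat_of_bool (Q (map val t)))) /=.
rewrite -val_enum_ord big_map big_enum; apply: eq_bigr => u _.
by rewrite val_enum_ord IHn.
Qed.

(** * The characteristic polynomial at large integers *)

Section MoebiusArrangement.
Local Open Scope classical_set_scope.
Variables (R : realType) (n : nat) (A : arrangement R n).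
Local Notation L := (intersection_poset A).
Implicit Types (v : 'rV[R]_n) (x : L).

Lemma flatP (X : set 'rV[R]_n) : reflect
  (exists2 B : {fset set 'rV[R]_n}, (B `<=` A)%fset & X = intersection B /\ X !=set0)
  (X \in flats A).
Proof.
rewrite !inE /=; apply: (iffP andP) => [[/imfsetP[B /=]]|[B BA [-> X0]]].
  by rewrite fpowersetE => BA -> /asboolP X0; exists B.
split; last exact/asboolP.
by apply/imfsetP; exists B => //=; rewrite fpowersetE.
Qed.

Definition planes_through v : {fset set 'rV[R]_n} :=
  [fset H in (A : {fset set 'rV[R]_n}) | `[< H v >]]%fset.

Lemma planes_throughP v H : reflect (H \in planes A /\ H v) (H \in planes_through v).
Proof.
rewrite !inE /=; apply: (iffP andP) => -[HA Hv]; split=> //; exact/asboolP.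
Qed.

Lemma flat_at_subproof v : intersection (planes_through v) \in flats A.
Proof.
apply/flatP; exists (planes_through v).
  by apply/fsubsetP => H /planes_throughP[].
by split=> //; exists v => H /= /planes_throughP[].
Qed.

Definition flat_at v : L := FSetSub (flat_at_subproof v).

(** [flat_at v] is the smallest flat containing [v], hence the greatest for reverse inclusion, so
    the flats through [v] form an order interval starting at [flat0]. *)
Lemma flat_atP v x : fsval x v <-> (x <= flat_at v)%O.
Proof.
split=> [xv|/asboolP le_x]; last by apply: le_x => H /= /planes_throughP[].
apply/asboolP => w vw; have /flatP[B BA [xE _]] := fsvalP x.
rewrite xE => H /= HB; apply: vw => /=; apply/planes_throughP; split.
  by have /fsubsetP := BA; apply.
by move: xv; rewrite xE; apply.
Qed.

Lemma flat0_le x : (flat0 A <= x)%O.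
Proof. exact/asboolP. Qed.

Lemma hyperplane_proper X : is_hyperplane X -> X <> [set: 'rV[R]_n].
Proof.
case=> a [b [a0 ->]] XT; case/rV0Pn: a0 => i ai0.
have in_X (w : 'rV[R]_n) : \sum_i a 0 i * w 0 i = b.
  by have : [set: 'rV[R]_n] w by []; rewrite -XT.
have b0 : b = 0 by rewrite -(in_X 0) big1 // => j _; rewrite mxE mulr0.
move: (in_X (delta_mx 0 i)); rewrite b0 (bigD1 i) //= big1 => [|j ji].
  by rewrite mxE !eqxx mulr1 addr0 => /eqP; rewrite (negPf ai0).
by rewrite mxE (negPf ji) andbF mulr0.
Qed.

Lemma flat_at_eq0 v :
  (flat_at v == flat0 A) = `[< forall H, H \in planes A -> ~ H v >].
Proof.
apply/eqP/asboolP => [v0 H HA Hv|vN].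
  apply: (hyperplane_proper (planesP HA)); apply/seteqP; split=> // w _.
  have : fsval (flat_at v) w by rewrite v0.
  by move/(_ H); apply; apply/planes_throughP.
apply: val_inj; apply/seteqP; split=> //= w _ H /= /planes_throughP[HA Hv].
by case: (vN H HA).
Qed.

(** The sum of the Moebius function over the interval from [flat0] to [flat_at v] is 0 unless the
    interval is a single point, that is, unless [v] lies on no hyperplane. *)
Lemma sum_moebius_at v :
  \sum_(x : L | `[< fsval x v >]) moebius (flat0 A) x =
  (`[< forall H, H \in planes A -> ~ H v >])%:R.
Proof.
rewrite -flat_at_eq0 (eq_bigl (fun x => (x <= flat_at v)%O)); last first.
  by move=> x; apply/asboolP/idP => /flat_atP.
case: eqVneq => [->|ne0].
  rewrite (big_pred1 (flat0 A)) ?moebius_xx // => x /=.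
  by rewrite eq_le flat0_le andbT.
have lt0 : (flat0 A < flat_at v)%O by rewrite lt_def ne0 flat0_le.
rewrite (bigD1 (flat_at v)) //= (moebius_lt lt0) addrC; apply/eqP.
rewrite subr_eq0; apply/eqP; apply: eq_bigl => x.
by rewrite flat0_le lt_neqAle andbC.
Qed.

(** The direction picked by [xget] agrees with any other: each vector of one direction is the
    difference of two points of [X], hence lies in the other. *)
Lemma affine_dim_direction (X : set 'rV[R]_n) U :
  is_direction X U -> affine_dim X = \dim U.
Proof.
move=> XU; rewrite /affine_dim; congr (\dim _).
have : is_direction X (xget 0%VS [set U | is_direction X U]).
  by apply: (xgetPex 0%VS); exists U.
move: (xget _ _) => U' XU'.
have sub U1 U2 : is_direction X U1 -> is_direction X U2 -> (U1 <= U2)%VS.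
  move=> [p XE] [p' XE']; apply/subvP => u uU1.
  have inX w : w \in U1 -> exists2 w', w' \in U2 & p + w = p' + w'.
    move=> wU1; have : X (p + w) by rewrite XE; exists w.
    by rewrite XE' => -[w' w'U2 <-]; exists w'.
  have [w wU2 pw] := inX 0 (mem0v _); have [w' w'U2 pw'] := inX u uU1.
  have -> : u = w' - w.
    apply: (addrI p); rewrite pw' addrCA [p - w](_ : _ = p'); last first.
      by apply/eqP; rewrite subr_eq -pw addr0.
    by rewrite addrC.
  exact: memvB.
by apply/eqP; rewrite eqEsubv !sub.
Qed.

End MoebiusArrangement.

(** The quotient of the indices by the equivalence generated by [D], with a section [g]. For the
    equations $v_i-v_j=1$ of a flat, its size [k] is both the real dimension and the exponent of $q$
    in the count of solutions modulo $q$. *)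
Lemma quotient_by_rel (n : nat) (D : rel 'I_n) :
  exists k (f : 'I_n -> 'I_k) (g : 'I_k -> 'I_n),
    [/\ cancel g f, forall i j, D i j -> f i = f j &
      forall (V : Type) (h : 'I_n -> V), (forall i j, D i j -> h i = h j) ->
        forall i, h (g (f i)) = h i].
Proof.
pose e : rel 'I_n := [rel i j | D i j || D j i].
have e_sym : connect_sym e.
  by apply: sym_connect_sym => i j; rewrite /e /= orbC.
pose rts := [set i | roots e i].
have in_rts i : fingraph.root e i \in rts by rewrite inE; apply: (roots_root e_sym).
exists #|rts|, (fun i => enum_rank_in (in_rts i) (fingraph.root e i)), enum_val; split.
- move=> i /=; have := enum_valP i; rewrite inE => /eqP ri.
  by apply: enum_val_inj; rewrite enum_rankK_in ?in_rts.
- move=> i j Dij /=; apply: enum_val_inj; rewrite !enum_rankK_in ?in_rts //.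
  by apply/(fingraph.rootP e_sym)/connect1; rewrite /e /= Dij.
move=> V h hD i /=; rewrite enum_rankK_in ?in_rts //.
have := connect_root e i => /connectP[p ep ->].
elim: p i ep => //= j p IHp i /andP[eij ep]; rewrite IHp //.
by case/orP: eij => /hD.
Qed.

(* Cutting the cycle of residues modulo [q] at a missing one. *)
Lemma tuple_integer_lift (n q : nat) (t : n.-tuple 'I_q) : (n < q)%N ->
  exists p : 'I_n -> nat, forall i j,
    tnth t i = ((tnth t j).+1 %% q)%N :> nat <-> p i = (p j).+1.
Proof.
move=> lt_nq; have [c c_notin] : exists c : 'I_q, c \notin t.
  apply/existsP; rewrite -negb_forall; apply/negP => /forallP t_all.
  have : (#|'I_q| <= #|t|)%N.
    by apply: subset_leq_card; apply/fintype.subsetP => c _; apply: t_all.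
  move/leq_trans/(_ (card_size t)); rewrite card_ord size_tuple.
  by rewrite leqNgt lt_nq.
have q0 : (0 < q)%N by apply: leq_trans lt_nq.
(* The distance from the missing residue [c] is never 0. So [(p j).+1] equal to [q] cannot match
   [p i] modulo [q], and congruence coincides with equality of integers. *)
pose p i := ((tnth t i + (q - c)) %% q)%N; exists p => i j.
have p_gt0 k : (0 < p k)%N.
  rewrite lt0n; apply: contra c_notin => /eqP pk0.
  suff -> : c = tnth t k by apply: mem_tnth.
  apply: val_inj => /=; apply/eqP; rewrite -(modn_small (ltn_ord c)).
  rewrite -(modn_small (ltn_ord (tnth t k))) -(eqn_modDr (q - c)).
  by rewrite subnKC ?modnn 1?ltnW // eq_sym -/(p k) pk0.
have -> : (p i = (p j).+1) <-> (p i == (p j).+1 %[mod q]).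
  split=> [->//|]; rewrite /p modn_mod -/(p i) -/(p j).
  have : ((p j).+1 <= q)%N by rewrite ltn_mod.
  rewrite leq_eqVlt => /predU1P[->|lt_q].
    by rewrite modnn => /eqP pi0; move: (p_gt0 i); rewrite pi0.
  by rewrite modn_small // => /eqP.
rewrite /p modn_mod -[(_ %% q).+1]addn1 modnDml addn1 -addSn eqn_modDr.
by rewrite (modn_small (ltn_ord _)); split=> [->|/eqP].
Qed.

Section LinialChi.
Variables (R : realType) (n : nat).
Local Notation L := (intersection_poset (linial R n)).

Lemma linial_planeP X : reflect
  (exists i j : 'I_n, (i < j)%N /\ X = [set v : 'rV[R]_n | v 0 i - v 0 j = 1]%classic)
  (X \in planes (linial R n)).
Proof.
rewrite -[X \in _]/(X \in linial_planes R n) /linial_planes.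
apply: (iffP (imfsetP _ _ _ _)) => [[[i j] /= lt_ij ->]|[i [j [lt_ij ->]]]].
  by exists i, j.
by exists (i, j).
Qed.

Lemma linial_flat_rel (x : L) : exists D : rel 'I_n, exists v0 : 'rV[R]_n,
  fsval x v0 /\ forall v, fsval x v <-> forall i j, D i j -> v 0 i - v 0 j = 1.
Proof.
have /flatP[B BA [xE [v0 xv0]]] := fsvalP x.
pose H (i j : 'I_n) := [set v : 'rV[R]_n | v 0 i - v 0 j = 1]%classic.
exists (fun i j => H i j \in B), v0; split=> //.
move=> v; rewrite xE; split=> [Bv i j /Bv //|Dv X /= XB].
have /linial_planeP[i [j [lt_ij XE]]] : X \in planes (linial R n).
  by have /fsubsetP := BA; apply.
by rewrite XE; apply: Dv; rewrite /H -XE.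
Qed.

(** Over the reals and over the residues alike, the solutions of the equations of [x] are a
    translate of the functions constant on the classes of [D]. Hence the dimension is the number [k]
    of classes, and the count is $q^k$. *)
Lemma linial_flat_count (q : nat) (pt : n.-tuple 'I_q -> 'rV[R]_n) (x : L) :
    (forall t i j, pt t 0 i - pt t 0 j = 1 <->
       tnth t i = ((tnth t j).+1 %% q)%N :> nat) -> (0 < q)%N ->
  #|[pred t | `[< fsval x (pt t) >] ]| = (q ^ (n - flat_rank x))%N.
Proof.
case: q pt => // q pt ptP _.
have [D [v0 [xv0 xP]]] := linial_flat_rel x.
have [k [f [g [gK fD lift]]]] := quotient_by_rel D.
have v0D : forall i j, D i j -> v0 0 i - v0 0 j = 1 by apply/xP.
have le_kn : (k <= n)%N.
  by rewrite -[k]card_ord -[n in (_ <= n)%N]card_ord (leq_card g (can_inj gK)).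
have rank_x : (n - flat_rank x)%N = k.
  (* The matrix of composition with [f]: its image, the vectors constant on classes, is the
     direction of the flat. *)
  pose M : 'M[R]_(k, n) := \matrix_(j, i) (f i == j)%:R.
  pose F := linfun (mulmxr M : 'rV_k -> 'rV_n).
  have FE w i : F w 0 i = w 0 (f i).
    rewrite lfunE /= mxE (bigD1 (f i)) //= big1 ?addr0 => [|j jf].
      by rewrite mxE eqxx mulr1.
    by rewrite mxE eq_sym (negPf jf) mulr0.
  have F_inj : lker F = 0%VS.
    apply/eqP/lker0P => w w' ww'; apply/rowP => j.
    by rewrite -(gK j) -!FE ww'.
  rewrite /flat_rank (@affine_dim_direction _ _ _ (limg F)).
    by rewrite limg_dim_eq ?dimvf ?dim_matrix ?mul1r ?subKn // F_inj capv0.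
  exists v0; apply/seteqP; split=> [v /xP xv|_ /= [u /memv_imgP[w _ ->] <-]].
    exists (v - v0); last by rewrite addrC subrK.
    apply/memv_imgP; exists (\row_j (v - v0) 0 (g j)); first exact: memvf.
    apply/rowP => i; rewrite FE [RHS]mxE; symmetry.
    apply: (lift _ (fun i => (v - v0) 0 i)) => i1 j1 Dij.
    apply/eqP; rewrite -subr_eq0 !mxE.
    have -> : v 0 i1 - v0 0 i1 - (v 0 j1 - v0 0 j1) =
      (v 0 i1 - v 0 j1) - (v0 0 i1 - v0 0 j1) by ring.
    by rewrite xv // v0D // subrr.
  apply/xP => i j Dij; rewrite !mxE !FE (fD _ _ Dij) -(v0D _ _ Dij).
  by rewrite opprD addrACA subrr addr0.
rewrite rank_x -[in RHS](card_ord q.+1) -card_tuple.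
(* A particular solution modulo [q.+1]: the floors of the coordinates of [v0] satisfy the same unit
   differences. *)
pose a0 i : 'I_q.+1 := inZp 1 *~ Num.floor (v0 0 i).
have a0D i j : D i j -> a0 i = a0 j + inZp 1.
  move=> Dij; rewrite /a0 -[X in _ = _ + X]mulr1z -mulrzDr; congr (_ *~ _).
  have -> : v0 0 i = v0 0 j + 1 by rewrite -(v0D i j Dij) addrC subrK.
  by rewrite floorDrz ?floor1.
have plus1 (u w : 'I_q.+1) : u = (w.+1 %% q.+1)%N :> nat <-> u = w + inZp 1.
  have wE : (w + inZp 1 : 'I_q.+1) = (w.+1 %% q.+1)%N :> nat.
    by rewrite /= modnDmr addn1.
  by rewrite -wE; split=> [/val_inj|->].
pose Phi (w : k.-tuple 'I_q.+1) := [tuple tnth w (f i) + a0 i | i < n].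
have Phi_inj : injective Phi.
  move=> w w' ww'; apply: eq_from_tnth => j; rewrite -(gK j).
  have /(congr1 (fun t => tnth t (g j))) := ww'.
  by rewrite !tnth_mktuple => /addIr.
rewrite -(card_codom Phi_inj); apply: eq_card => t; rewrite !inE.
apply/asboolP/idP => [/xP xt|/codomP[w ->]].
  apply/codomP; exists [tuple tnth t (g j) - a0 (g j) | j < k].
  apply: eq_from_tnth => i; rewrite !tnth_mktuple.
  apply/eqP; rewrite -subr_eq eq_sym; apply/eqP.
  apply: (lift _ (fun i => tnth t i - a0 i)) => i1 j1 Dij.
  have /ptP/plus1-> := xt i1 j1 Dij; rewrite (a0D _ _ Dij).
  by rewrite opprD addrACA subrr addr0.
apply/xP => i j Dij; apply/ptP/plus1.
by rewrite !tnth_mktuple (fD _ _ Dij) (a0D _ _ Dij) addrA.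
Qed.

(** Each residue word is lifted to an integer point with the same incidences, which [n < q] permits.
    The Moebius values summed over incident pairs of flat and point give the characteristic
    polynomial flat by flat, and the number of words off the arrangement point by point. *)
Lemma linial_chi_count (q : nat) : (n < q)%N ->
  (map_poly intr (chi (linial R n)) : {poly rat}).[q%:R] =
  (wcount (iota 0 q) n (cyclic_word q))%:R.
Proof.
move=> lt_nq; have q0 : (0 < q)%N by apply: leq_trans lt_nq.
have [P PE] := choice (fun t : n.-tuple 'I_q => tuple_integer_lift t lt_nq).
pose pt t : 'rV[R]_n := \row_i (P t i)%:R.
have ptP t i j : pt t 0 i - pt t 0 j = 1 <->
    tnth t i = ((tnth t j).+1 %% q)%N :> nat.
  rewrite PE !mxE; split=> [/eqP|->]; last by rewrite -natr1 addrAC subrr add0r.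
  by rewrite subr_eq addrC natr1 eqr_nat => /eqP.
rewrite /chi rmorph_sum horner_sum wcount_tuple natr_sum.
pose mu (x : L) : rat := (moebius (flat0 (linial R n)) x)%:~R.
transitivity (\sum_(x : L) \sum_(t | `[< fsval x (pt t) >]) mu x).
  apply: eq_bigr => x _; rewrite /= map_polyZ map_polyXn hornerZ hornerXn.
  by rewrite sumr_const (linial_flat_count x ptP q0) -[RHS]mulr_natr natrX.
rewrite (exchange_big_dep xpredT) //=; apply: eq_bigr => t _.
rewrite -rmorph_sum sum_moebius_at rmorph_nat; congr (_ _)%:R.
apply/asboolP/(pairwiseP 0%N).
  move=> free i j; rewrite !inE size_map size_tuple => lt_in lt_jn lt_ij.
  rewrite !(nth_map (Ordinal q0)) ?size_tuple //.
  rewrite -(tnth_nth _ t (Ordinal lt_in)) -(tnth_nth _ t (Ordinal lt_jn)).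
  apply/eqP => /ptP tij.
  apply: (free [set v : 'rV[R]_n |
    v 0 (Ordinal lt_in) - v 0 (Ordinal lt_jn) = 1]%classic) => //.
  by apply/linial_planeP; exists (Ordinal lt_in), (Ordinal lt_jn).
move=> cyc H /linial_planeP[i [j [lt_ij ->]]] /= /ptP tij.
have := cyc i j; rewrite !inE size_map size_tuple !ltn_ord => /(_ isT isT lt_ij).
by rewrite !(nth_map (Ordinal q0)) ?size_tuple // -!tnth_nth tij eqxx.
Qed.

Lemma linial_chi_linial_gf (q : nat) : (n < q)%N ->
  (map_poly intr (chi (linial R n)) : {poly rat}).[q%:R] =
  if n is n'.+1 then q%:R * (n'`!%:R * linial_gf q.-1 n') else 1.
Proof.
move=> lt_nq; rewrite (linial_chi_count lt_nq); case: (n) => // n'.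
by rewrite cyclic_wcount natrM /linial_gf (egf_coef rat_natU).
Qed.

End LinialChi.

(** * Alternating trees *)

(** An edge may go to a path or be contracted, so this applies to retractions of a tree onto one of
    its pieces. *)
Lemma connect_hom (T U : finType) (e : rel T) (e' : rel U) (f : T -> U) :
  (forall x y, e x y -> connect e' (f x) (f y)) ->
  forall x y, connect e x y -> connect e' (f x) (f y).
Proof.
move=> ef x y /connectP[p ep ->] {y}; elim: p x ep => //= z p IHp x /andP[exz ep].
exact: connect_trans (ef _ _ exz) (IHp _ ep).
Qed.

(** * Trees on a subset of the vertices, described by bridges *)

Section TreeOn.
Variable T : finType.
Implicit Types (E : {set T * T}) (S : {set T}).

Definition del_edge E a b : rel T :=
  [rel u v | [&& (u, v) \in E, (u, v) != (a, b) & (u, v) != (b, a)]].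

Definition all_bridges E : Prop :=
  forall a b, (a, b) \in E -> ~~ connect (del_edge E a b) a b.

Lemma del_edge_sym E a b : symmetric (adjacent E) -> symmetric (del_edge E a b).
Proof.
move=> symE u v; rewrite /del_edge /= [(u, v) \in E](symE u v) !xpair_eqE.
by rewrite [(v == a) && _]andbC [(v == b) && _]andbC [in RHS](andbC (~~ _)).
Qed.

(** A simple path joining the ends of an edge without using it closes to a cycle; conversely a cycle
    without its first edge still joins the ends of that edge. *)
Lemma acyclicP E : is_graph E -> is_acyclic E <-> all_bridges E.
Proof.
move=> [symE irrE]; split=> [acyc a b abE|bridge c c_uniq c_size].
  apply/negP => /connectP[p0 /shortenP[p ep p_uniq _] bE].
  have neq_ab : a != b by apply: contraTneq abE => ->; apply/negbT/irrE.
  have sub_e : subrel (del_edge E a b) (adjacent E) by move=> u v /and3P[].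
  have := acyc _ p_uniq; case: p bE ep p_uniq => [|u [|v p]] bE ep p_uniq.
  - by rewrite bE eqxx in neq_ab.
  - by move: ep; rewrite bE /del_edge /= eqxx andbF.
  move/(_ isT)/negP; case; rewrite (cycle_path a) /= -/(path _ _ _).
  rewrite [last v p](esym bE) symE [adjacent E a b]abE /=; exact: sub_path sub_e _ _ ep.
apply/negP => cyc; case: c c_uniq c_size cyc => [|u [|w c]] //= uniq_c c_size.
rewrite rcons_path => /andP[uwE /andP[pc lastE]].
have {uniq_c} [u_notin w_notin] : u \notin w :: c /\ w \notin c.
  by move: uniq_c => /and3P[].
apply: (negP (bridge u w uwE)).
rewrite (sym_connect_sym (del_edge_sym u w symE)).
have neq_wu : w != u by apply: contraNneq u_notin => ->; rewrite mem_head.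
have last_c : last w c \in c.
  by case: c c_size {pc lastE u_notin w_notin} => //= a c _; rewrite mem_last.
apply: (@connect_trans _ _ (last w c)); last first.
  apply: connect1; rewrite /del_edge /= [_ \in _]lastE !xpair_eqE eqxx andbT /=.
  rewrite [u == w]eq_sym (negPf neq_wu) andbF /=.
  by apply: contraNneq w_notin => <-.
apply/connectP; exists c => //.
have sub_e : {in predC1 u &, subrel (adjacent E) (del_edge E u w)}.
  move=> x y xu yu xyE; rewrite /del_edge /= [_ \in _]xyE !xpair_eqE.
  by rewrite (negPf xu) (negPf yu) andbF.
apply: (sub_in_path sub_e) pc; apply/allP => v.
by apply: contraTneq => ->.
Qed.

Definition tree_on S E : Prop :=
  [/\ E \subset finset.setX S S, symmetric (adjacent E),
      {in S &, forall u v, connect (adjacent E) u v} & all_bridges E].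

Lemma tree_on_irr S E : tree_on S E -> irreflexive (adjacent E).
Proof.
move=> [_ _ _ bridge] u; apply/negbTE/negP => /bridge.
by rewrite connect0.
Qed.

Lemma tree_onP E : is_tree E <-> tree_on [set: T] E.
Proof.
split=> [[gE cE aE]|tE].
  split; [| by case: gE | by move=> u v _ _; apply: cE |].
    by apply/fintype.subsetP => -[u v]; rewrite !inE.
  exact/acyclicP.
have irrE := tree_on_irr tE; case: tE => _ symE cE bE.
by split=> // [u v|]; [apply: cE; rewrite inE | apply/acyclicP].
Qed.

Definition alternates (lt : rel T) E : Prop := forall v,
  (forall w, adjacent E v w -> lt w v) \/ (forall w, adjacent E v w -> lt v w).

Definition is_top (lt : rel T) E v : bool :=
  [forall w, adjacent E v w ==> lt w v].

Definition alt_trees lt S : {set {set T * T}} :=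
  [set E | `[< tree_on S E /\ alternates lt E >]].

(** The marked vertex exceeds its neighbours; it is the place where a smaller root can be attached
    without breaking alternation. *)
Definition top_trees lt S : {set {set T * T} * T} :=
  [set p | [&& p.1 \in alt_trees lt S, p.2 \in S & is_top lt p.1 p.2]].

Lemma alt_treesP lt S E :
  reflect (tree_on S E /\ alternates lt E) (E \in alt_trees lt S).
Proof. by rewrite inE; apply: asboolP. Qed.

End TreeOn.

(** * Invariance under order-preserving relabelling *)

Section Transport.
Variables (T T' : finType) (f : T -> T') (lt : rel T) (lt' : rel T').
Hypothesis f_inj : injective f.
Hypothesis f_lt : forall u v, lt' (f u) (f v) = lt u v.
Implicit Types (E : {set T * T}) (S : {set T}).

Definition edge_map (p : T * T) : T' * T' := (f p.1, f p.2).

Lemma edge_map_inj : injective edge_map.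
Proof. by move=> [u v] [u' v'] [/f_inj-> /f_inj->]. Qed.

Lemma mem_edge_map E u v : ((f u, f v) \in edge_map @: E) = ((u, v) \in E).
Proof. exact: (mem_imset _ (u, v) edge_map_inj). Qed.

Lemma edge_mapP E x y : (x, y) \in edge_map @: E ->
  exists u v, [/\ x = f u, y = f v & (u, v) \in E].
Proof. by case/imsetP => -[u v] uvE [-> ->]; exists u, v. Qed.

Lemma connect_transport (e : rel T) (e' : rel T') :
    (forall u v, e' (f u) (f v) = e u v) ->
    (forall u y, e' (f u) y -> exists v, y = f v) ->
  forall u v, connect e' (f u) (f v) = connect e u v.
Proof.
move=> ee' e'f u v; apply/idP/idP; last first.
  by apply: connect_hom => x y; rewrite -ee'; apply: connect1.
case/connectP => p; elim: p u => [|y p IHp] u /=.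
  by move=> _ /f_inj->; rewrite connect0.
move=> /andP[/[dup] /e'f[w ->]]; rewrite ee' => /connect1 uw ep vE.
exact: connect_trans uw (IHp _ ep vE).
Qed.

Lemma tree_on_transport S E : tree_on (f @: S) (edge_map @: E) <-> tree_on S E.
Proof.
have cE u v : connect (adjacent (edge_map @: E)) (f u) (f v) =
    connect (adjacent E) u v.
  apply: connect_transport => [x y|x y /edge_mapP[_ [w [_ -> _]]]].
    exact: mem_edge_map.
  by exists w.
have cdE a b u v : connect (del_edge (edge_map @: E) (f a) (f b)) (f u) (f v) =
    connect (del_edge E a b) u v.
  apply: connect_transport => [x y|x y /and3P[/edge_mapP[_ [w [_ -> _]]]]].
    by rewrite /del_edge /= mem_edge_map !xpair_eqE !(inj_eq f_inj).
  by exists w.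
split=> -[subE symE conE brE]; split.
- apply/fintype.subsetP => -[u v] uvE.
  have /(fintype.subsetP subE) : edge_map (u, v) \in edge_map @: E by apply: imset_f.
  by rewrite !inE /= !mem_imset.
- by move=> u v; have := symE (f u) (f v); rewrite /adjacent !mem_edge_map.
- by move=> u v uS vS; rewrite -cE; apply: conE; apply: imset_f.
- by move=> a b abE; rewrite -cdE; apply: brE; rewrite mem_edge_map.
- apply/fintype.subsetP => -[x y] /edge_mapP[u [v [-> -> uvE]]].
  by have /(fintype.subsetP subE) := uvE; rewrite !inE /= !mem_imset.
- move=> x y; apply/idP/idP => /edge_mapP[u [v [-> -> uvE]]].
    by rewrite /adjacent mem_edge_map -[_ \in _]symE.
  by rewrite /adjacent mem_edge_map -[_ \in _]symE.
- by move=> _ _ /imsetP[u uS ->] /imsetP[v vS ->]; rewrite cE; apply: conE.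
- by move=> x y /edge_mapP[a [b [-> -> abE]]]; rewrite cdE; apply: brE.
Qed.

Lemma alternates_transport E :
  alternates lt' (edge_map @: E) <-> alternates lt E.
Proof.
split=> altE v.
  by case: (altE (f v)) => h; [left | right] => w vwE; rewrite -f_lt;
    apply: h; rewrite /adjacent mem_edge_map.
case: (boolP [exists u, v == f u]) => [/existsP[u /eqP->]|nv]; last first.
  left=> w /edge_mapP[u [_ [vE _ _]]]; case/negP: nv; apply/existsP.
  by exists u; rewrite vE.
by case: (altE u) => h; [left | right] => _ /edge_mapP[_ [w [/f_inj<- -> uwE]]];
  rewrite f_lt; apply: h.
Qed.

Lemma is_top_transport E v : is_top lt' (edge_map @: E) (f v) = is_top lt E v.
Proof.
apply/forallP/forallP => top w; apply/implyP.
  move=> vwE; rewrite -f_lt; apply: (implyP (top _)).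
  by rewrite /adjacent mem_edge_map.
by move=> /edge_mapP[_ [u [/f_inj<- -> uwE]]]; rewrite f_lt; apply: (implyP (top u)).
Qed.

Lemma alt_trees_transport S :
  alt_trees lt' (f @: S) = [set edge_map @: E | E : {set T * T} in alt_trees lt S].
Proof.
apply/setP => E'; apply/alt_treesP/imsetP => [[tE' aE']|[E /alt_treesP[tE aE] ->]].
  pose E := edge_map @^-1: E'.
  have E'E : E' = edge_map @: E.
    apply/setP => -[x y]; apply/idP/imsetP => [xyE'|[p pE ->]].
      case: tE' => /fintype.subsetP/(_ _ xyE') + _ _ _.
      rewrite inE => /andP[/imsetP[u uS /= xE] /imsetP[v vS /= yE]].
      by exists (u, v); rewrite ?inE /edge_map /= -?xE -?yE.
    by rewrite inE in pE.
  exists E => //; apply/alt_treesP; split.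
    by apply/tree_on_transport; rewrite -E'E.
  by apply/alternates_transport; rewrite -E'E.
by split; [apply/tree_on_transport | apply/alternates_transport].
Qed.

Lemma card_alt_trees_transport S : #|alt_trees lt' (f @: S)| = #|alt_trees lt S|.
Proof.
by rewrite alt_trees_transport card_imset //; apply/imset_inj/edge_map_inj.
Qed.

Lemma card_top_trees_transport S : #|top_trees lt' (f @: S)| = #|top_trees lt S|.
Proof.
pose h (p : {set T * T} * T) := (edge_map @: p.1, f p.2).
have h_inj : injective h.
  by move=> [E u] [E' u'] [/(imset_inj edge_map_inj)-> /f_inj->].
rewrite -(card_imset _ h_inj); congr #|pred_of_set _|; apply/setP => -[E' x].
rewrite inE alt_trees_transport; apply/and3P/imsetP => /=.
  move=> [/imsetP[E tE ->] /imsetP[u uS ->]]; rewrite is_top_transport => topu.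
  by exists (E, u) => //; rewrite inE /= tE uS.
move=> [[E u]]; rewrite inE => /and3P[tE uS topu] [-> ->].
by split; [apply: imset_f | apply: imset_f | rewrite is_top_transport].
Qed.

End Transport.

(** * Cutting a tree between its smallest vertex and a branch *)

Section Decomposition.
Variables (T : finType) (lt : rel T) (r w : T).
Hypothesis r_min : forall v, v != r -> lt r v && ~~ lt v r.
Implicit Types (E : {set T * T}) (S : {set T}).

Definition avoid_edge E : rel T :=
  [rel u v | [&& (u, v) \in E, u != r & v != r]].

(** The component of [w] after deletion of the vertex [r]. *)
Definition branch E : {set T} := [set u | connect (avoid_edge E) w u].

Definition glue (p : {set T * T} * T * {set T * T}) : {set T * T} :=
  p.1.1 :|: p.2 :|: [set (r, p.1.2); (p.1.2, r)].

Lemma avoid_edge_sym E : symmetric (adjacent E) -> symmetric (avoid_edge E).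
Proof.
move=> symE u v; rewrite /avoid_edge /= [_ \in _](symE u v).
by rewrite [(u != r) && _]andbC.
Qed.

Section Glue.
Variables (S : {set T}) (E1 E2 : {set T * T}) (v : T).
Hypothesis wS : w \in S.
Hypothesis rS : r \notin S.
Hypothesis tE1 : (E1, v) \in top_trees lt S.
Hypothesis tE2 : E2 \in alt_trees lt (~: S).

Let E := glue (E1, v, E2).

Let vS : v \in S. Proof. by move: tE1; rewrite inE => /and3P[]. Qed.

Let neq_vr : v != r. Proof. by apply: contraNneq rS => <-. Qed.

Let E1S x y : (x, y) \in E1 -> x \in S /\ y \in S.
Proof.
move: tE1; rewrite inE => /and3P[/alt_treesP[[/fintype.subsetP sub _ _ _] _] _ _].
by move/sub; rewrite inE => /andP[].
Qed.

Let E2S x y : (x, y) \in E2 -> x \notin S /\ y \notin S.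
Proof.
case/alt_treesP: tE2 => [[/fintype.subsetP sub _ _ _] _].
by move/sub; rewrite !inE => /andP[].
Qed.

Let EP x y : (x, y) \in E ->
  [\/ [/\ (x, y) \in E1, x \in S & y \in S],
      [/\ (x, y) \in E2, x \notin S & y \notin S],
      (x, y) = (r, v) | (x, y) = (v, r)].
Proof.
rewrite !inE => /orP[/orP[xyE|xyE]|/orP[]/eqP xyE].
- by have [xS yS] := E1S xyE; constructor 1.
- by have [xS yS] := E2S xyE; constructor 2.
- by constructor 3.
- by constructor 4.
Qed.

Let sub1 : subrel (adjacent E1) (adjacent E).
Proof. by move=> x y; rewrite /adjacent !inE => ->. Qed.

Let sub2 : subrel (adjacent E2) (adjacent E).
Proof. by move=> x y; rewrite /adjacent !inE => ->; rewrite orbT. Qed.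

Let rvE : adjacent E r v.
Proof. by rewrite /adjacent !inE eqxx orbT. Qed.

Let symE : symmetric (adjacent E).
Proof.
move: tE1 tE2; rewrite inE => /and3P[/alt_treesP[[_ s1 _ _] _] _ _].
move=> /alt_treesP[[_ s2 _ _] _] x y.
rewrite /adjacent !inE -![_ \in E1]/(adjacent E1 _ _) -![_ \in E2]/(adjacent E2 _ _).
rewrite (s1 x) (s2 x) !xpair_eqE; congr (_ || _).
by rewrite orbC [(x == v) && _]andbC [(x == r) && _]andbC.
Qed.

Lemma branch_glue : branch E = S.
Proof.
move: tE1; rewrite inE => /and3P[/alt_treesP[[_ _ c1 _] _] _ _].
apply/setP => u; rewrite inE; apply/idP/idP => [wu|uS].
  have clS : closed (avoid_edge E) (mem S).
    move=> x y /and3P[/EP[[_ xS yS]|[_ xS yS]|[-> _]|[_ ->]] xr yr].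
    - by rewrite /= xS yS.
    - by rewrite /= (negPf xS) (negPf yS).
    - by rewrite eqxx in xr.
    - by rewrite eqxx in yr.
  by rewrite -[_ \in _](closed_connect clS wu).
apply: connect_sub (c1 w u wS uS) => x y xyE; apply: connect1.
have [xS yS] := E1S xyE; rewrite /avoid_edge /= [_ \in _](sub1 xyE) /=.
by apply/andP; split; [apply: contraNneq rS => <- | apply: contraNneq rS => <-].
Qed.

(** The new edge is the only one crossing [S], hence a bridge; any other edge stays a bridge because
    collapsing the opposite piece retracts the graph onto its own piece. Alternation survives since
    [v] is a top and [r] lies below everything. *)
Lemma glue_tree : E \in alt_trees lt [set: T].
Proof.
move: (tE1) (tE2); rewrite inE => /and3P[/alt_treesP[t1 a1] _ /forallP topv].
move=> /alt_treesP[t2 a2]; have irr2 := tree_on_irr t2.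
case: t1 t2 => [_ s1 c1 b1] [_ s2 c2 b2].
have symc := sym_connect_sym symE.
apply/alt_treesP; split; first split.
- by apply/fintype.subsetP => -[x y]; rewrite !inE.
- exact: symE.
- have toR u : connect (adjacent E) u r.
    case: (boolP (u \in S)) => uS.
      apply: connect_trans (_ : connect (adjacent E) v r); last first.
        by rewrite symc; apply: connect1.
      by apply: connect_sub (c1 u v uS vS) => x y /sub1; apply: connect1.
    have rS' : r \in ~: S by rewrite inE.
    have uS' : u \in ~: S by rewrite inE.
    by apply: connect_sub (c2 u r uS' rS') => x y /sub2; apply: connect1.
  by move=> u u' _ _; apply: connect_trans (toR u) _; rewrite symc.
- have cut a b : (a, b) = (r, v) \/ (a, b) = (v, r) ->
      closed (del_edge E a b) (mem S).
    move=> ab x y /and3P[/EP[[_ xS yS]|[_ xS yS]|xy|xy] xyab xyba].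
    + by rewrite /= xS yS.
    + by rewrite /= (negPf xS) (negPf yS).
    + by case: ab => -[aE bE]; move: xyab xyba; rewrite aE bE xy eqxx.
    + by case: ab => -[aE bE]; move: xyab xyba; rewrite aE bE xy eqxx.
  move=> a b abE; apply/negP => cab; case/EP: (abE).
  + move=> [abE1 aS bS]; apply: (negP (b1 a b abE1)).
    (* Collapsing the complement of [S] to [v] contracts the new edge and turns a walk avoiding an
       edge of [E1] into a walk of [E1] avoiding it. *)
    pose p x := if x \in S then x else v.
    have pa : p a = a by rewrite /p aS.
    have pb : p b = b by rewrite /p bS.
    rewrite -[X in connect _ X]pa -[X in connect _ _ X]pb.
    apply: connect_hom cab => x y /and3P[xyE xyab xyba].
    case/EP: (xyE) => [[xyE1 xS yS]|[_ xS yS]|[-> ->]|[-> ->]].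
    * rewrite /p xS yS; apply: connect1; rewrite /del_edge /= xyE1.
      by rewrite xyab.
    * by rewrite /p (negPf xS) (negPf yS).
    * by rewrite /p vS (negPf rS).
    * by rewrite /p vS (negPf rS).
  + move=> [abE2 aS bS]; apply: (negP (b2 a b abE2)).
    pose p x := if x \in S then r else x.
    have pa : p a = a by rewrite /p (negPf aS).
    have pb : p b = b by rewrite /p (negPf bS).
    rewrite -[X in connect _ X]pa -[X in connect _ _ X]pb.
    apply: connect_hom cab => x y /and3P[xyE xyab xyba].
    case/EP: (xyE) => [[_ xS yS]|[xyE2 xS yS]|[-> ->]|[-> ->]].
    * by rewrite /p xS yS.
    * rewrite /p (negPf xS) (negPf yS); apply: connect1.
      by rewrite /del_edge /= xyE2 xyab.
    * by rewrite /p vS (negPf rS).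
    * by rewrite /p vS (negPf rS).
  + move=> ab; have := closed_connect (cut a b (or_introl ab)) cab.
    by case: ab => -> -> /=; rewrite vS (negPf rS).
  + move=> ab; have := closed_connect (cut a b (or_intror ab)) cab.
    by case: ab => -> -> /=; rewrite vS (negPf rS).
move=> u; case: (eqVneq u r) => [->|neq_ur].
  right=> y ryE; suff /r_min/andP[] : y != r by [].
  case/EP: (ryE) => [[_ rS1 _]|[ryE2 _ _]|[->]|[/eqP]]; rewrite ?neq_vr //.
  - by move: rS; rewrite rS1.
  - by apply: contraTneq ryE2 => ->; apply/negbT/irr2.
  - by rewrite eq_sym (negPf neq_vr).
case: (eqVneq u v) => [->|neq_uv].
  left=> y vyE; case/EP: (vyE) => [[vyE1 _ _]|[_ vS1 _]|[/eqP]|[->]].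
  - exact: (implyP (topv y)).
  - by rewrite vS in vS1.
  - by rewrite (negPf neq_vr).
  - by case/andP: (r_min neq_vr).
have uE y : adjacent E u y -> adjacent E1 u y \/ adjacent E2 u y.
  case/EP => [[uyE _ _]|[uyE _ _]|[/eqP]|[/eqP]].
  - by left.
  - by right.
  - by rewrite (negPf neq_ur).
  - by rewrite (negPf neq_uv).
case: (boolP (u \in S)) => uS.
  by case: (a1 u) => h; [left | right] => y /uE[/h //|/E2S[]]; rewrite uS.
by case: (a2 u) => h; [left | right] => y /uE[/E1S[]|/h //]; rewrite (negPf uS).
Qed.

Lemma glueK : E :&: finset.setX S S = E1 /\ E :&: finset.setX (~: S) (~: S) = E2.
Proof.
split; apply/setP => -[x y]; rewrite [LHS]inE [X in _ && X]inE /=.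
  apply/andP/idP => [[/EP + /andP[xS yS]]|xyE1].
    case=> [[]|[_]|[xr _]|[_ yr]] //; rewrite ?xS //.
      by rewrite xr (negPf rS) in xS.
    by rewrite yr (negPf rS) in yS.
  by have [-> ->] := E1S xyE1; split=> //; apply: sub1.
apply/andP/idP => [[/EP + /andP[]]|xyE2]; rewrite !finset.in_setC.
  case=> [[_ -> _]|[]|[_ ->]|[-> _]] //; first by rewrite vS.
  by rewrite vS.
by have [-> ->] := E2S xyE2; split=> //; apply: sub2.
Qed.

Lemma glue_root x : x \in S -> (r, x) \in E -> x = v.
Proof.
move=> xS /EP[[_ rS1 _]|[_ _ xS1]|[]|[_ xr]] //.
- by move: rS; rewrite rS1.
- by rewrite xS in xS1.
- by rewrite xr (negPf rS) in xS.
Qed.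

End Glue.

(** Connectedness gives an edge from [r] into the branch, and it is unique, since with a second one
    neither would be a bridge. Its end [v] has the smaller neighbour [r], so by alternation it is a
    top. *)
Lemma branchP E : w != r -> E \in alt_trees lt [set: T] ->
  [/\ w \in branch E, r \notin branch E &
  exists p, [/\ p.1 \in top_trees lt (branch E),
                p.2 \in alt_trees lt (~: branch E) & E = glue p]].
Proof.
move=> neq_wr /alt_treesP[tE aE]; have irrE := tree_on_irr tE.
case: tE => [_ symE cE bE]; set S := branch E.
have csym := sym_connect_sym (avoid_edge_sym symE).
have wS : w \in S by rewrite inE connect0.
have rS : r \notin S.
  rewrite inE csym; apply/negP => /connectP[[|y p] /=].
    by move=> _ /eqP; rewrite (negPf neq_wr).
  by move=> /andP[/and3P[_ /eqP]].
have stepS x y : (x, y) \in E -> y != r -> x \in S -> y \in S.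
  move=> xyE yr xS; have xr : x != r by apply: contraNneq rS => <-.
  move: xS; rewrite !inE => /connect_trans; apply; apply: connect1.
  by rewrite /avoid_edge /= xyE xr.
have [v vS rvE] : exists2 v, v \in S & (r, v) \in E.
  apply/exists_inP; rewrite -[X in is_true X]negbK; apply/negP => no_v.
  have clS : closed (adjacent E) (mem S).
    have cl x y : adjacent E x y -> x \in S -> y \in S.
      move=> xyE xS; case: (eqVneq y r) => [yr|yr]; last exact: stepS xyE yr xS.
      case/negP: no_v; apply/exists_inP; exists x => //.
      by rewrite -[_ \in _]/(adjacent E r x) symE -yr.
    by move=> x y xyE; apply/idP/idP; apply: cl; rewrite // symE.
  have := closed_connect clS (cE w r (finset.in_setT _) (finset.in_setT _)).
  by rewrite /= wS (negPf rS).
have neq_vr : v != r by apply: contraNneq rS => <-.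
have v_uniq x : x \in S -> (r, x) \in E -> x = v.
  move=> xS rxE; apply/eqP; apply: contraT => neq_xv.
  case/negP: (bE r v rvE).
  apply: (@connect_trans _ _ x).
    apply: connect1; rewrite /del_edge /= rxE !xpair_eqE eqxx (negPf neq_xv) /=.
    by rewrite [r == v]eq_sym (negPf neq_vr).
  have : connect (avoid_edge E) x v.
    have SP y : (y \in S) = connect (avoid_edge E) w y by rewrite inE.
    by apply: (@connect_trans _ _ w); [rewrite csym -SP | rewrite -SP].
  apply: connect_sub => a b /and3P[abE ar br]; apply: connect1.
  by rewrite /del_edge /= abE !xpair_eqE (negPf ar) (negPf br) andbF.
pose E1 := E :&: finset.setX S S; pose E2 := E :&: finset.setX (~: S) (~: S).
have E1P x y : ((x, y) \in E1) = [&& (x, y) \in E, x \in S & y \in S].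
  by rewrite inE [X in _ && X]inE.
have E2P x y : ((x, y) \in E2) = [&& (x, y) \in E, x \notin S & y \notin S].
  by rewrite inE [X in _ && X]inE /= !(finset.in_setC).
have crossP x y : (x, y) \in E -> x \in S -> y \notin S -> x = v /\ y = r.
  move=> xyE xS yS; have yr : y = r.
    by apply/eqP; apply: contraNT yS => yr; apply: stepS xyE yr xS.
  split=> //; apply: v_uniq => //.
  by rewrite -[_ \in _]/(adjacent E r x) symE -yr.
split=> //; exists (E1, v, E2).
have sub1 : subrel (adjacent E1) (adjacent E).
  by move=> x y; rewrite /adjacent E1P => /and3P[].
have sub2 : subrel (adjacent E2) (adjacent E).
  by move=> x y; rewrite /adjacent E2P => /and3P[].
have bridge_sub F : subrel (adjacent F) (adjacent E) -> all_bridges F.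
  move=> subF a b abF; apply: contraTN (bE a b (subF a b abF)) => cab.
  rewrite negbK; apply: connect_sub cab => x y /and3P[xyF xyab xyba].
  apply: connect1.
  by rewrite /del_edge /= [_ \in E](subF _ _ xyF) xyab.
have alt_sub F : subrel (adjacent F) (adjacent E) -> alternates lt F.
  by move=> subF u; case: (aE u) => h; [left | right] => y /subF; apply: h.
split.
- rewrite inE /= vS; apply/and3P; split=> //.
    apply/alt_treesP; split; last exact: alt_sub.
    split; last exact: bridge_sub.
    + exact: subsetIr.
    + move=> x y; rewrite /adjacent !E1P -![_ \in E]/(adjacent E _ _) symE.
      by rewrite [(x \in S) && _]andbC.
    pose p x := if x \in S then x else v.
    move=> a b aS bS; have pa : p a = a by rewrite /p aS.
    have pb : p b = b by rewrite /p bS.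
    rewrite -[X in connect _ X]pa -[X in connect _ _ X]pb.
    apply: connect_hom (cE a b (finset.in_setT _) (finset.in_setT _)).
    move=> x y xyE.
    rewrite /p; case: (boolP (x \in S)) => xS; case: (boolP (y \in S)) => yS //.
    + by apply: connect1; rewrite /adjacent E1P [_ \in E]xyE xS.
    + by have [-> _] := crossP x y xyE xS yS.
    + by have [|-> _] := crossP y x _ yS xS; rewrite // -[_ \in _]/(adjacent E y x) symE.
  apply/forallP => y; apply/implyP => /sub1; case: (aE v) => h; first exact: h.
  have : adjacent E v r by rewrite symE.
  by move/h; case/andP: (r_min neq_vr) => _ /negPf->.
- apply/alt_treesP; split; last exact: alt_sub.
  split; last exact: bridge_sub.
  + exact: subsetIr.
  + move=> x y; rewrite /adjacent !E2P -![_ \in E]/(adjacent E _ _) symE.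
    by rewrite [(x \notin S) && _]andbC.
  pose p x := if x \in S then r else x.
  move=> a b; rewrite !finset.in_setC => aS bS.
  have pa : p a = a by rewrite /p (negPf aS).
  have pb : p b = b by rewrite /p (negPf bS).
  rewrite -[X in connect _ X]pa -[X in connect _ _ X]pb.
  apply: connect_hom (cE a b (finset.in_setT _) (finset.in_setT _)).
  move=> x y xyE.
  rewrite /p; case: (boolP (x \in S)) => xS; case: (boolP (y \in S)) => yS //.
  + by have [_ ->] := crossP x y xyE xS yS.
  + by have [|_ ->] := crossP y x _ yS xS; rewrite // -[_ \in _]/(adjacent E y x) symE.
  + by apply: connect1; rewrite /adjacent E2P [_ \in E]xyE xS.
apply/setP => -[x y]; rewrite /glue /= !finset.in_setU E1P E2P !finset.in_set1 !xpair_eqE.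
apply/idP/idP => [xyE|].
  rewrite xyE /=; case: (boolP (x \in S)) => xS; case: (boolP (y \in S)) => yS //=.
    by have [-> ->] := crossP x y xyE xS yS; rewrite !eqxx orbT.
  have [|-> ->] := crossP y x _ yS xS; last by rewrite !eqxx.
  by rewrite -[_ \in _]/(adjacent E y x) symE.
case/orP => [/orP[/and3P[]|/and3P[]]|/orP[]] //.
  by case/andP => /eqP-> /eqP->.
by case/andP => /eqP-> /eqP->; rewrite -[_ \in _]/(adjacent E v r) symE.
Qed.

Lemma card_alt_trees_branch : w != r ->
  #|alt_trees lt [set: T]| =
  (\sum_(S : {set T} | (w \in S) && (r \notin S))
     #|top_trees lt S| * #|alt_trees lt (~: S)|)%N.
Proof.
move=> neq_wr; rewrite -sum1_card
  (partition_big branch (fun S => (w \in S) && (r \notin S))).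
  apply: eq_bigr => S /andP[wS rS]; rewrite sum1_card -cardsX.
  rewrite -(card_in_imset (f := glue)); last first.
    move=> [[E1 v] E2] [[E1' v'] E2']; rewrite !finset.in_setX /=.
    move=> /andP[t1 t2] /andP[t1' t2'] eqE.
    have [K1 K2] := glueK rS t1 t2; have [K1' K2'] := glueK rS t1' t2'.
    move: K1 K2; rewrite eqE K1' K2' => <- <-; congr (_, _, _).
    apply: (glue_root rS t1' t2').
      by move: t1; rewrite inE => /and3P[].
    by rewrite -eqE !inE /= eqxx orbT.
  apply: eq_card => E; rewrite unfold_in; apply/andP/imsetP => [[tE /eqP bE]|].
    have [_ _ [[[E1 v] E2]]] := branchP neq_wr tE; rewrite bE => -[t1 t2 EE].
    by exists (E1, v, E2); rewrite ?finset.in_setX ?t1.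
  move=> [[[E1 v] E2]]; rewrite finset.in_setX => /andP[t1 t2] ->; split.
    exact: glue_tree t1 t2.
  by apply/eqP; apply: branch_glue t1 t2.
by move=> E /(branchP neq_wr)[-> ->].
Qed.

End Decomposition.

(** * Recurrence and functional equation for alternating trees *)

Definition ord_lt (m : nat) : rel 'I_m := fun u v => (u < v)%N.
Definition ord_gt (m : nat) : rel 'I_m := fun u v => (v < u)%N.

Definition topped_trees (m : nat) : nat := #|top_trees (@ord_lt m) [set: 'I_m]|.

Lemma alternating_treesE m :
  alternating_trees m = #|alt_trees (@ord_lt m) [set: 'I_m]|.
Proof.
apply: eq_card => E; rewrite [RHS]inE unfold_in; apply/asboolP/asboolP.
  by case=> /tree_onP.
by case=> /tree_onP.
Qed.

Lemma enum_val_lt m (S : {set 'I_m}) (i j : 'I_#|S|) :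
  (enum_val i < enum_val j)%N = (i < j)%N.
Proof.
have S_sorted : sorted ltn (map val (enum S)).
  apply: (subseq_sorted ltn_trans _ (iota_ltn_sorted 0 m)).
  by rewrite -(val_enum_ord m) map_subseq // enumT filter_subseq.
have homo (a b : 'I_#|S|) : (a < b)%N -> (enum_val a < enum_val b)%N.
  move=> ab; have x0 := enum_default a.
  have sz (c : 'I_#|S|) : (c < size (enum S))%N by rewrite -cardE.
  rewrite !(enum_val_nth x0) -!(nth_map x0 (val x0) val) //.
  by apply: (sorted_ltn_nth ltn_trans); rewrite ?inE ?size_map.
case: (ltngtP i j) => [/homo//|/homo/ltnW|/val_inj->]; last by rewrite ltnn.
by rewrite leqNgt => /negPf.
Qed.

Lemma imset_enum_val (T : finType) (S : {set T}) :
  enum_val @: [set: 'I_#|S|] = S.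
Proof.
apply/setP => u; apply/imsetP/idP => [[i _ ->]|uS]; first exact: enum_valP.
by exists (enum_rank_in uS u); rewrite ?enum_rankK_in.
Qed.

Lemma card_alt_trees_ord m (S : {set 'I_m}) :
  #|alt_trees (@ord_lt m) S| = alternating_trees #|S|.
Proof.
rewrite alternating_treesE -{1}[S]imset_enum_val.
by apply: card_alt_trees_transport; [exact: enum_val_inj | exact: enum_val_lt].
Qed.

Lemma card_top_trees_ord m (S : {set 'I_m}) :
  #|top_trees (@ord_lt m) S| = topped_trees #|S|.
Proof.
rewrite /topped_trees -{1}[S]imset_enum_val.
by apply: card_top_trees_transport; [exact: enum_val_inj | exact: enum_val_lt].
Qed.

Lemma card_top_treesE (T : finType) (lt : rel T) :
  #|top_trees lt [set: T]| =
  (\sum_(E in alt_trees lt [set: T]) \sum_(v : T) is_top lt E v)%N.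
Proof.
rewrite -sum1_card big_mkcond pair_big_dep [RHS]big_mkcond; apply: eq_bigr => -[E v] _.
rewrite inE /= finset.in_setT andbT /=.
by case: (E \in _) => //=; case: is_top.
Qed.

Lemma alternating_trees1 : alternating_trees 1 = 1%N.
Proof.
rewrite alternating_treesE (_ : alt_trees _ _ = [set finset.set0]) ?cards1 //.
apply/setP => E; rewrite finset.in_set1; apply/alt_treesP/eqP => [[tE _]|->].
  apply/setP => -[u v]; rewrite finset.in_set0 [u]ord1 [v]ord1.
  exact: (tree_on_irr tE).
split; last by move=> v; left => u; rewrite /adjacent finset.in_set0.
split=> [|u v|u v _ _|u v]; rewrite ?finset.sub0set ?/adjacent ?finset.in_set0 //.
by rewrite [u]ord1 [v]ord1.
Qed.

(* Reversing the order exchanges the two types of vertices. *)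
Lemma double_topped_trees m :
  ((topped_trees m).*2 = m * alternating_trees m + (m == 1))%N.
Proof.
have rev : topped_trees m = #|top_trees (@ord_gt m) [set: 'I_m]|.
  have -> : [set: 'I_m] = (@rev_ord m) @: [set: 'I_m].
    apply/setP => u; rewrite finset.in_setT; symmetry; apply/imsetP.
    by exists (rev_ord u); rewrite ?rev_ordK.
  symmetry; rewrite /topped_trees; apply: card_top_trees_transport.
    exact: rev_ord_inj.
  by move=> u v; rewrite /ord_gt /ord_lt /=; have := ltn_ord u; have := ltn_ord v; lia.
have alt_gt : alt_trees (@ord_gt m) [set: 'I_m] = alt_trees (@ord_lt m) [set: 'I_m].
  apply/setP => E; apply/alt_treesP/alt_treesP => -[tE aE]; split=> // v;
  by case: (aE v); [right | left].
rewrite -addnn {2}rev {1}/topped_trees !card_top_treesE alt_gt -big_split /=.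
(* A vertex is a top for exactly one of the two orders, except the isolated vertex for [m] equal to
   1, which is a top for both. *)
have one E (v : 'I_m) : E \in alt_trees (@ord_lt m) [set: 'I_m] ->
    (is_top (@ord_lt m) E v + is_top (@ord_gt m) E v = 1 + (m == 1))%N.
  move=> /alt_treesP[tE aE]; have irrE := tree_on_irr tE.
  case: tE => _ symE cE _.
  have top_dis : m != 1%N -> is_top (@ord_lt m) E v -> is_top (@ord_gt m) E v -> False.
    move=> m1 /forallP top1 /forallP top2.
    have no_nbr u : ~~ adjacent E v u.
      apply/negP => vu; have := implyP (top1 u) vu; have := implyP (top2 u) vu.
      by rewrite /ord_lt /ord_gt /=; lia.
    have m0 : (0 < m)%N by apply: leq_ltn_trans (ltn_ord v).
    have /existsP[u neq_uv] : [exists u : 'I_m, u != v].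
      apply: contraT; rewrite negb_exists => /forallP all_v.
      have : (#|'I_m| <= #|pred1 v|)%N.
        apply: subset_leq_card; apply/fintype.subsetP => u _; rewrite inE.
        by have := all_v u; rewrite negbK.
      by rewrite card_ord card1; case: (m) m1 m0 => [|[]].
    have /connectP[[|y p] /=] := cE v u (finset.in_setT _) (finset.in_setT _).
      by move=> _ uv; rewrite uv eqxx in neq_uv.
    by move=> /andP[vy _] _; have := no_nbr y; rewrite vy.
  have some_top : is_top (@ord_lt m) E v || is_top (@ord_gt m) E v.
    by case: (aE v) => h; apply/orP; [left | right]; apply/forallP => u;
      apply/implyP => /h.
  case: (eqVneq m 1%N) => [m1|m1].
    have no_nbr lt : is_top lt E v.
      apply/forallP => u; apply/implyP => vu.
      have uv : u = v.
        by apply: val_inj => /=; have := ltn_ord u; have := ltn_ord v; lia.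
      by move: vu; rewrite uv irrE.
    by rewrite !no_nbr.
  move: some_top (top_dis m1); do 2!case: is_top => //=.
  by move=> _ /(_ isT isT).
have -> : (\sum_(E in alt_trees (@ord_lt m) [set: 'I_m])
    (\sum_(v : 'I_m) is_top (@ord_lt m) E v + \sum_(v : 'I_m) is_top (@ord_gt m) E v)
  = \sum_(E in alt_trees (@ord_lt m) [set: 'I_m]) m * (1 + (m == 1)))%N.
  apply: eq_bigr => E tE; rewrite -big_split /=.
  by under eq_bigr => v _ do rewrite one //; rewrite sum_nat_const card_ord.
rewrite sum_nat_const -alternating_treesE; case: eqP => [->|_].
  by rewrite alternating_trees1.
by rewrite addn0 muln1 mulnC addn0.
Qed.

Lemma sum_subsets_card (T : finType) (r w : T) n (F : nat -> nat) :
    #|T| = n.+2 -> w != r ->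
  (\sum_(S : {set T} | (w \in S) && (r \notin S)) F #|S| =
   \sum_(k < n.+1) 'C(n, k) * F k.+1)%N.
Proof.
move=> cardT neq_wr; pose B := ~: [set r; w].
have cardB : #|B| = n by rewrite cardsCs finset.setCK cardT cards2 eq_sym neq_wr subn2.
have BP u : (u \in B) = (u != r) && (u != w) by rewrite !inE negb_or.
rewrite (reindex_onto (fun S => w |: S) (fun S => S :\ w)); last first.
  by move=> S /andP[wS _]; apply: finset.setD1K.
transitivity (\sum_(S : {set T} | S \subset B) F #|S|.+1)%N.
  have wB : w \notin B by rewrite BP eqxx andbF.
  apply: eq_big => S; last first.
    move=> /andP[_ /eqP SE]; congr F; rewrite cardsU1 -[in LHS]SE.
    by rewrite finset.in_setD1 eqxx SE.
  rewrite finset.in_setU1 eqxx finset.in_setU1 negb_or [r == w]eq_sym neq_wr /=.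
  apply/andP/fintype.subsetP => [[rS /eqP SE] u uS|SB].
    rewrite BP; move: (uS); rewrite -SE finset.in_setD1 => /andP[-> _].
    by rewrite andbT; apply: contraNneq rS => <-.
  split; first by apply/negP => /SB; rewrite BP eqxx.
  by apply/eqP/finset.setU1K; apply: contra wB => /SB.
rewrite (partition_big (fun S : {set T} => inord #|S| : 'I_n.+1) xpredT) //=.
apply: eq_bigr => k _; rewrite -[n in 'C(n, _)]cardB -cards_draws.
rewrite -sum_nat_const; apply: eq_big => [S|S /andP[SB /eqP Sk]].
  rewrite inE; case: (boolP (S \subset B)) => //= SB.
  rewrite -val_eqE /= inordK // ltnS -cardB.
  exact: subset_leq_card.
congr (F _.+1); rewrite -Sk inordK // ltnS -cardB.
exact: subset_leq_card.
Qed.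

(** The cut is taken with the smallest vertex as [r] and the largest as [w]; the other [k] vertices
    of the branch are chosen among the [n] remaining ones. *)
Lemma alternating_trees_rec n :
  alternating_trees n.+2 =
  (\sum_(k < n.+1) 'C(n, k) * (topped_trees k.+1 * alternating_trees (n - k).+1))%N.
Proof.
have r_min (v : 'I_n.+2) : v != ord0 -> ord_lt ord0 v && ~~ ord_lt v ord0.
  by rewrite -val_eqE /ord_lt /= lt0n => ->.
rewrite alternating_treesE (card_alt_trees_branch (w := ord_max) r_min) //.
under eq_bigr => S _ do rewrite card_alt_trees_ord card_top_trees_ord
  [#|~: S|]cardsCs finset.setCK card_ord.
rewrite (sum_subsets_card
  (fun k => topped_trees k * alternating_trees (n.+2 - k))%N (n := n)) ?card_ord //.
apply: eq_bigr => k _; rewrite subSS subSn //.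
by rewrite -ltnS.
Qed.

Definition tree_gf : fps rat := egf (fun n => (alternating_trees n.+1)%:R).

Definition topped_gf : fps rat := egf (fun n => (topped_trees n)%:R).

Lemma tree_gf_deriv : fps_deriv tree_gf = fps_deriv topped_gf * tree_gf.
Proof.
rewrite !(fps_deriv_egf rat_natU); apply/fpsP => n; rewrite fps_coefM.
rewrite [LHS]/= alternating_trees_rec natr_sum mulr_suml; apply: eq_bigr => k _ /=.
have le_kn : (k <= n)%N by rewrite -ltnS.
rewrite -(bin_fact le_kn) !natrM.
have kU : k`!%:R != 0 :> rat by rewrite pnatr_eq0 -lt0n fact_gt0.
have nkU : (n - k)`!%:R != 0 :> rat by rewrite pnatr_eq0 -lt0n fact_gt0.
have bU : 'C(n, k)%:R != 0 :> rat by rewrite pnatr_eq0 -lt0n bin_gt0.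
by field; rewrite ?kU ?nkU ?bU.
Qed.

(** Marking any of the [n.+1] vertices multiplies [tree_gf] by $x$; the summand 1 accounts for the
    single vertex, a top for both orders. *)
Lemma topped_gf_double : topped_gf *+ 2 = fpsX * (1 + tree_gf).
Proof.
apply/fpsP => -[|n]; rewrite fps_coefMn.
  have t0 : topped_trees 0 = 0%N.
    by move: (double_topped_trees 0); rewrite mul0n; case: topped_trees.
  by rewrite fps_coefXM0 /= t0 mul0r mul0rn.
rewrite fps_coefXM fps_coefD fps_coef1 /= -mulrnAl -mulrnA muln2.
rewrite double_topped_trees factS natrD !natrM eqSS.
have nU : n.+1%:R != 0 :> rat by rewrite pnatr_eq0.
have fU : n`!%:R != 0 :> rat by rewrite pnatr_eq0 -lt0n fact_gt0.
case: n nU fU => [|n] nU fU; first by rewrite fact0 !mul1r !divr1 addrC.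
by rewrite addr0 add0r -mulf_div divff // mul1r.
Qed.

Lemma tree_gf_coef0 : tree_gf 0%N = 1.
Proof. by rewrite /= alternating_trees1 divr1. Qed.

(** With $t$ for [topped_gf], $f'=t'f$ gives $(f^2)'=2t'f^2=(x(1+f))'f^2$, the equation that
    characterises the exponential. *)
Lemma tree_gf_eq : tree_gf ^+ 2 = fps_exp (fpsX * (1 + tree_gf)).
Proof.
apply: (fps_expP rat_natU); first exact: fps_coefXM0.
  rewrite -topped_gf_double (raddfMn (@fps_deriv rat)) fps_derivXn tree_gf_deriv /=.
  by ring.
by rewrite fps_coef0X tree_gf_coef0 expr1n.
Qed.

(** The substitution of $-x$ for $x$. *)
Definition fps_alt (f : fps rat) : fps rat := Fps (fun n => (-1) ^+ n * f n).

Fact fps_alt_is_zmod_morphism : zmod_morphism fps_alt.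
Proof. by move=> f g; apply/fpsP => n; rewrite /= mulrBr. Qed.

Fact fps_alt_is_monoid_morphism : monoid_morphism fps_alt.
Proof.
split=> [|f g]; apply/fpsP => n.
  by case: n => [|n] /=; rewrite ?mulr1 ?mulr0.
rewrite fps_coefM -[LHS]/((-1) ^+ n * (f * g) n) fps_coefM mulr_sumr.
apply: eq_bigr => i _ /=.
rewrite mulrACA -exprD subnKC //.
by rewrite -ltnS.
Qed.

HB.instance Definition _ := GRing.isZmodMorphism.Build (fps rat) (fps rat)
  fps_alt fps_alt_is_zmod_morphism.
HB.instance Definition _ := GRing.isMonoidMorphism.Build (fps rat) (fps rat)
  fps_alt fps_alt_is_monoid_morphism.

Lemma fps_alt_exp u : fps_alt (fps_exp u) = fps_exp (fps_alt u).
Proof.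
apply/fpsP => n; rewrite /= mulr_sumr; apply: eq_bigr => k _.
by rewrite -rmorphXn /= mulrA.
Qed.

Lemma fps_alt_X : fps_alt fpsX = - fpsX.
Proof.
by apply/fpsP => -[|[|n]] /=; rewrite ?mulr0 ?oppr0 ?mulr1 ?expr1.
Qed.

Lemma alt_tree_gf_eq :
  fps_alt tree_gf ^+ 2 * fps_exp (fpsX * (1 + fps_alt tree_gf)) = 1.
Proof.
rewrite -rmorphXn /= tree_gf_eq fps_alt_exp rmorphM rmorphD rmorph1 /= fps_alt_X.
rewrite -(fps_expD rat_natU) ?fps_coefXM0 //.
  by rewrite mulNr addNr (fps_exp0 rat_natU).
by rewrite mulNr fps_coefN fps_coefXM0 oppr0.
Qed.

(** * Comparison of the two expansions *)

Lemma poly_eq_on_nat (p q : {poly rat}) N :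
  (forall k, (N <= k)%N -> p.[k%:R] = q.[k%:R]) -> p = q.
Proof.
move=> pq; apply/eqP; rewrite -subr_eq0; apply: contraT => nz.
pose s : seq rat := [seq k%:R | k <- iota N (size (p - q))].
have s_roots : all (root (p - q)) s.
  apply/allP => z /mapP[k]; rewrite mem_iota => /andP[le_Nk _] ->.
  by rewrite rootE hornerD hornerN pq // subrr.
have s_uniq : uniq s.
  by rewrite map_inj_uniq ?iota_uniq // => i j /eqP; rewrite eqr_nat => /eqP.
by have := max_poly_roots nz s_roots s_uniq; rewrite size_map size_iota ltnn.
Qed.

Lemma eventually_up_to (P : nat -> nat -> Prop) :
  (forall b, exists N, forall r, (N <= r)%N -> P b r) ->
  forall b, exists N, forall r, (N <= r)%N -> forall c, (c <= b)%N -> P c r.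
Proof.
move=> evP; elim=> [|b [N IHN]].
  by have [N PN] := evP 0%N; exists N => r le_Nr c; rewrite leqn0 => /eqP->; apply: PN.
have [M PM] := evP b.+1; exists (maxn N M) => r; rewrite geq_max => /andP[Nr Mr] c.
by rewrite leq_eqVlt => /predU1P[->|]; [apply: PM | rewrite ltnS; apply: IHN].
Qed.

Lemma eq_fps_coefM (f g h : fps rat) b :
  (forall c, (c <= b)%N -> f c = g c) -> (f * h) b = (g * h) b.
Proof.
by move=> fg; rewrite !fps_coefM; apply: eq_bigr => i _; rewrite fg // -ltnS.
Qed.

Section Limits.
Variables (G : fps rat).
Hypothesis G0 : G 0%N = 1.
Hypothesis G_eq : G ^+ 2 * fps_exp (fpsX * (1 + G)) = 1.

Let A_unit r : A_ r \is a GRing.unit.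
Proof. by rewrite fps_unitE A_linial_gf linial_gf_coef0. Qed.

Let GU : G \is a GRing.unit. Proof. by rewrite fps_unitE G0. Qed.

Let A_near b := eventually_up_to (A_eventually G0 G_eq) b.

Lemma A_ratio_lim : fps_lim (fun r => A_ r / A_ r.-1) G^-1.
Proof.
move=> b; have [N AN] := A_near b; exists N.+1 => -[//|r] lt_Nr.
(* The limit is written with the same denominator [A_ r], so that only the numerators [A_ r.+1] and
   $FA_r$ are compared, up to degree [b]; both are $F'F^{r+1}$ there. *)
rewrite -[in RHS](divrK (A_unit r) G^-1) [in RHS]mulrAC.
apply: eq_fps_coefM => c le_cb; rewrite AN ?leqW //.
transitivity ((fps_deriv G^-1 * G^-1 ^+ r * G^-1) c).
  by rewrite exprSr mulrA.
rewrite [G^-1 * A_ _]mulrC; apply: eq_fps_coefM => d le_dc.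
by rewrite -AN // (leq_trans le_dc).
Qed.

Lemma A_ratio_inv_lim : fps_lim (fun r => A_ r.-1 / A_ r) G.
Proof.
move=> b; have [N AN] := A_near b; exists N.+1 => -[//|r] lt_Nr.
rewrite -[in RHS](divrK (A_unit r.+1) G) [in RHS]mulrAC.
apply: eq_fps_coefM => c le_cb; rewrite AN //.
transitivity ((fps_deriv G^-1 * G^-1 ^+ r.+1 * G) c).
  by rewrite exprSr mulrA divrK.
rewrite [G * A_ _]mulrC; apply: eq_fps_coefM => d le_dc.
by rewrite -AN ?leqW // (leq_trans le_dc).
Qed.

Lemma fps_powq_nat (F : fps rat) n q : F 0%N = 1 ->
  (fps_powq F n).[q%:R] = (F ^+ q) n.
Proof.
move=> F0; pose ev : {rmorphism fps {poly rat} -> fps rat} :=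
  fps_map (horner_eval (q%:R : rat)).
transitivity (ev (fps_powq F) n); first by [].
have -> : ev (fps_powq F) =
    fps_exp (ev (fpsC 'X * fps_map polyC (fps_log F))).
  exact: (fps_map_exp poly_rat_natU).
have -> : ev (fpsC 'X * fps_map polyC (fps_log F)) = fps_log F *+ q.
  apply/fpsP => k; rewrite fps_coefMn.
  transitivity ((fpsC ('X : {poly rat}) * fps_map polyC (fps_log F)) k).[q%:R].
    by [].
  by rewrite fps_coefCM hornerM hornerX hornerC mulr_natl.
by rewrite (fps_exp_Mn rat_natU) ?fps_log_coef0 // (fps_exp_log rat_natU).
Qed.

(** At a large integer $q$ and for $n>0$, $\chi_n(q)=q(n-1)![x^{n-1}]A_{q-1}$, and $A_{q-1}$ may be
    replaced by $F'F^{q-1}$. Since $qF'F^{q-1}=(F^q)'$, this is $n![x^n]F^q$; agreement at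
    infinitely many integers gives the polynomial identity. *)
Lemma linial_chi_egf (R : realType) :
  egf (fun n => map_poly intr (chi (linial R n)) : {poly rat}) = fps_powq G^-1.
Proof.
have F0 : G^-1 0%N = 1.
  have /fpsP/(_ 0%N) : G^-1 * G = 1 by exact: mulVr.
  by rewrite fps_coef0M G0 mulr1.
apply/fpsP => n.
have nU : n`!%:R \is a @GRing.unit {poly rat}.
  by case: n`! (fact_gt0 n) => // k _; apply: poly_rat_natU.
apply: (mulrI nU); rewrite (egf_coef poly_rat_natU).
have [N AN] := A_eventually G0 G_eq n.-1.
apply: (@poly_eq_on_nat _ _ (maxn N n).+1) => q.
rewrite gtn_max => /andP[lt_Nq lt_nq].
rewrite (linial_chi_linial_gf R lt_nq) hornerM fps_powq_nat //.
rewrite -[n`!%:R](rmorph_nat polyC) hornerC.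
case: n nU AN lt_nq => [|n] _ AN lt_nq.
  by rewrite fps_coef0X F0 expr1n mulr1.
have coefX : (G^-1 ^+ q) n.+1 *+ n.+1 = q%:R * linial_gf q.-1 n.
  rewrite -fps_derivE fps_derivXn fps_coefMn -A_linial_gf AN //; last first.
    by case: q lt_Nq lt_nq.
  by rewrite mulr_natl [fps_deriv _ * _]mulrC.
rewrite factS natrM mulrCA -coefX -[_ *+ n.+1]mulr_natr.
by ring.
Qed.

End Limits.

Theorem theorem4p15 (R : realType) :
  (exists F : fps rat,
     fps_lim (fun r : nat => A_ r / A_ r.-1) F /\
     egf (fun n : nat => map_poly intr (chi (linial R n)) : {poly rat})
       = fps_powq F) /\
  fps_lim (fun r : nat => A_ r.-1 / A_ r)
    (egf (fun n : nat => (-1) ^+ n * (alternating_trees n.+1)%:R)).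
Proof.
have G0 : fps_alt tree_gf 0%N = 1 by rewrite /= mul1r alternating_trees1 divr1.
have GE := alt_tree_gf_eq; split.
  exists (fps_alt tree_gf)^-1; split; first exact: A_ratio_lim.
  exact: linial_chi_egf.
have -> : egf (fun n => (-1) ^+ n * (alternating_trees n.+1)%:R) = fps_alt tree_gf.
  by apply/fpsP => n; rewrite /= mulrA.
exact: A_ratio_inv_lim.
Qed.
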